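(* Let $\Omega\subseteq\mathbb{R}^n$ be open. The map $\mathcal{B}(\Omega)\to\mathcal{B}^{\mathrm{c}}(\Omega)$, $R\mapsto\widetilde R$, has the following properties: (i) $\widetilde{\iota u}=\iota^{\mathrm{c}}u$ for $u\in\mathcal{D}'(\Omega)$. (ii) $\widetilde{\sigma f}=\sigma^{\mathrm{c}}f$ for $f\in C^\infty(\Omega)$. (iii) $\widetilde R\in\mathcal{M}^{\mathrm{c}}(\Omega)$ for $R\in\mathcal{M}(\Omega)$. (iv) $\widetilde R\in\mathcal{N}^{\mathrm{c}}(\Omega)$ for $R\in\mathcal{N}(\Omega)$.
   Context: Notation: $\mathbb{N}_0=\{0,1,2,\dots\}$, $\mathbb{R}^+=[0,\infty)$. $K\Subset L$ means that $K$ is compact and contained in the interior of $L$. $\mathcal{U}_x(\Omega)$ is the set of open neighborhoods of $x$ in $\Omega$. $C^\infty(U)$ is the space of complex-valued smooth functions on $U$, $\mathcal{D}(\Omega)$ the space of test functions with its usual topology, $\mathcal{D}'(\Omega)$ the space of distributions, $\mathcal{D}_L(U)$ the space of test functions on $U$ with support in $L$. Smoothness of maps between locally convex spaces is understood in the sense of convenient calculus (Kriegl--Michor), and $\mathrm{d}^k R$ denotes the $k$-th differential. Basic space: $\mathcal{B}(\Omega)$ is the set of sheaf homomorphisms from $C^\infty(-,\mathcal{D}(\Omega))$ to $C^\infty(-)$, both regarded as sheaves on $\Omega$ with values in the category of locally convex spaces with smooth maps. That is, $R\in\mathcal{B}(\Omega)$ is a family $(R_U)_U$ of smooth maps $R_U: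 C^\infty(U,\mathcal{D}(\Omega))\to C^\infty(U)$ ($U\subseteq\Omega$ open) with $R_U(\vec\varphi)|_V=R_V(\vec\varphi|_V)$ for all open $V\subseteq U$. One writes $R$ for $R_U$. Embeddings: $(\iota u)(\vec\varphi)(x)=\langle u,\vec\varphi(x)\rangle$ for $u\in\mathcal{D}'(\Omega)$ and $(\sigma f)(\vec\varphi)(x)=f(x)$ for $f\in C^\infty(\Omega)$, where $\vec\varphi\in C^\infty(U,\mathcal{D}(\Omega))$, $x\in U$. Seminorms: for $U\subseteq\Omega$ open, $K,L\Subset U$, $m,c,l\in\mathbb{N}_0$, $B$ a bounded set of smooth functions, and $\vec\varphi\in C^\infty(U,\mathcal{D}_L(U))$: $\|f\|_{K,m}=\sup_{x\in K,|\alpha|\le m}|\partial^\alpha f(x)|$; $\|\vec\varphi\|_{K,c;L,l}=\sup_{x\in K,|\alpha|\le c,\,y\in L,|\beta|\le l}|\partial_x^\alpha\partial_y^\beta\vec\varphi(x)(y)|$; $\|\vec\varphi\|_{K,c;B}=\sup_{x\in K,|\alpha|\le c,\,f\in B}|\int f(y)\,\partial_x^\alpha\vec\varphi(x)(y)\,dy|$; $\|\vec\varphi-\vec\delta\|_{K,c;B}=\sup_{x\in K,|\alpha|\le c,\,f\in B}|\int f(y)\,\partial_x^\alpha\vec\varphi(x)(y)\,dy-\partial^\alpha f(x)|$ (here $\vec\delta(x)=\delta_x$). Polynomials: $\mathcal{P}_k=\mathbb{R}^+[y_0,\dots,y_k]$ (polynomials with coefficients in $\mathbb{R}^+$); $\mathcal{I}_k=\{\lambda\in\mathbb{R}^+[y_0,\dots,y_k,z_0,\dots,z_k]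 : \lambda(y_0,\dots,y_k,0,\dots,0)=0\}$. $R\in\mathcal{B}(\Omega)$ is moderate ($R\in\mathcal{M}(\Omega)$) if: $(\forall x\in\Omega)(\exists U\in\mathcal{U}_x(\Omega))(\forall K,L\Subset U)(\forall m,k\in\mathbb{N}_0)(\exists c,l\in\mathbb{N}_0)(\exists\lambda\in\mathcal{P}_k)(\forall\vec\varphi_0,\dots,\vec\varphi_k\in C^\infty(U,\mathcal{D}_L(U)))$: $\|\mathrm{d}^kR(\vec\varphi_0)(\vec\varphi_1,\dots,\vec\varphi_k)\|_{K,m}\le\lambda(\|\vec\varphi_0\|_{K,c;L,l},\dots,\|\vec\varphi_k\|_{K,c;L,l})$. $R\in\mathcal{B}(\Omega)$ is negligible ($R\in\mathcal{N}(\Omega)$) if: $(\forall x\in\Omega)(\exists U\in\mathcal{U}_x(\Omega))(\forall K,L\Subset U)(\forall m,k\in\mathbb{N}_0)(\exists c,l\in\mathbb{N}_0)(\exists\lambda\in\mathcal{I}_k)(\exists B\subseteq C^\infty(\Omega)\text{ bounded})(\forall\vec\varphi_0,\dots,\vec\varphi_k\in C^\infty(U,\mathcal{D}_L(U)))$: $\|\mathrm{d}^kR(\vec\varphi_0)(\vec\varphi_1,\dots,\vec\varphi_k)\|_{K,m}\le\lambda(\|\vec\varphi_0\|_{K,c;L,l},\dots,\|\vec\varphi_k\|_{K,c;L,l},\|\vec\varphi_0-\vec\delta\|_{K,c;B},\|\vec\varphi_1\|_{K,c;B},\dots,\|\vec\varphi_k\|_{K,c;B})$. Elementary version: $U(\Omega)=\{(\varphi,x)\in\mathcal{D}(\mathbb{R}^n)\times\Omega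 : x+\operatorname{supp}\varphi\subseteq\Omega\}$. $\mathcal{B}^{\mathrm{c}}(\Omega)$ is the set of all maps $R:U(\Omega)\to\mathbb{C}$ such that $R(\varphi,\cdot)$ is smooth (on the open set of $x$ with $(\varphi,x)\in U(\Omega)$) for each fixed $\varphi$. $(\iota^{\mathrm{c}}u)(\varphi,x)=\langle u,\varphi(\cdot-x)\rangle$, $(\sigma^{\mathrm{c}}f)(\varphi,x)=f(x)$. For $\varphi\in\mathcal{D}(\mathbb{R}^n)$ put $\varphi^\star(x)(y)=\varphi(y-x)$ and $\|\varphi\|_c=\sup_{x\in\mathbb{R}^n,|\alpha|\le c}|\partial^\alpha\varphi(x)|$; $\|\varphi^\star-\vec\delta\|_{K,c;B}$ is given by the formula for $\|\vec\varphi-\vec\delta\|_{K,c;B}$ with $\vec\varphi=\varphi^\star$. $R\in\mathcal{M}^{\mathrm{c}}(\Omega)$ iff $R\in\mathcal{B}^{\mathrm{c}}(\Omega)$ and $(\forall x\in\Omega)(\exists U\in\mathcal{U}_x(\Omega))(\forall K,L\Subset U: K\Subset L)(\forall m\in\mathbb{N}_0)(\exists c\in\mathbb{N}_0)(\exists\lambda\in\mathcal{P}_0)(\forall\varphi\in\mathcal{D}(\mathbb{R}^n): K+\operatorname{supp}\varphi\subseteq L)$: $\|R(\varphi,\cdot)\|_{K,m}\le\lambda(\|\varphi\|_c)$. $R\in\mathcal{N}^{\mathrm{c}}(\Omega)$ iff $R\in\mathcal{B}^{\mathrm{c}}(\Omega)$ and $(\forall x\in\Omega)(\exists U\in\mathcal{U}_x(\Omega))(\forall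 K,L\Subset U: K\Subset L)(\forall m\in\mathbb{N}_0)(\exists c\in\mathbb{N}_0)(\exists\lambda\in\mathcal{I}_0)(\exists B\subseteq C^\infty(U)\text{ bounded})(\forall\varphi\in\mathcal{D}(\mathbb{R}^n): K+\operatorname{supp}\varphi\subseteq L)$: $\|R(\varphi,\cdot)\|_{K,m}\le\lambda(\|\varphi\|_c,\|\varphi^\star-\vec\delta\|_{K,c;B})$. The map: for $R\in\mathcal{B}(\Omega)$, $\widetilde R\in\mathcal{B}^{\mathrm{c}}(\Omega)$ is defined by $\widetilde R(\varphi,x)=R(\vec\varphi)(x)$ for $(\varphi,x)\in U(\Omega)$, where $\vec\varphi\in C^\infty(\Omega,\mathcal{D}(\Omega))$ is any element with $\vec\varphi=\varphi^\star$ in a neighborhood of $x$ (such $\vec\varphi$ exists and the value does not depend on its choice). *)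

(* Defs.v *)
From HB Require Import structures.
From mathcomp Require Import all_boot all_order all_algebra.
From mathcomp Require Import all_classical all_reals all_analysis.
From mathcomp.real_closed Require Import complex.
From mathcomp Require mpoly.
Import numFieldNormedType.Exports.
Import Order.TTheory GRing.Theory Num.Theory.

Set Implicit Arguments.
Unset Strict Implicit.
Unset Printing Implicit Defensive.

Local Open Scope classical_set_scope.
Local Open Scope ring_scope.
Local Open Scope complex_scope.

Local Notation normc := ComplexField.Normc.normc.

Definition well_inside (T : topologicalType) (K L : set T) : Prop :=
  compact K /\ K `<=` L°.

(* A locally convex space is presented as a linear subspace [lcs_carrier] of an
   ambient complex vector space, with the topology generated by a family of
   seminorms; only the values of the seminorms on the carrier are meaningful.
   All the spaces built below are complete and Hausdorff. *)
Record lcs (R : realType) := LCS {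
  lcs_ambient :> lmodType R[i];
  lcs_carrier : set lcs_ambient;
  lcs_seminorms : set (lcs_ambient -> R) }.

Arguments lcs_carrier {R} E _ : rename.

Section LocallyConvex.
Variable R : realType.
Local Notation lcs := (lcs R).

Definition is_curve_deriv (E : lcs) (c : R -> E) (t : R) (l : E) : Prop :=
  lcs_carrier E l /\
  forall p, lcs_seminorms p ->
    p (((h^-1)%:C *: (c (t + h) - c t)) - l) @[h --> 0^'] --> (0 : R).

Definition curve_deriv (E : lcs) (c : R -> E) (t : R) : E :=
  xget 0 [set l | is_curve_deriv c t l].

Definition smooth_curve (E : lcs) (c : R -> E) : Prop :=
  (forall t, lcs_carrier E (c t)) /\
  forall (k : nat) t, exists l, is_curve_deriv (iter k (@curve_deriv E) c) t l.

(* Smoothness in the sense of convenient calculus: smooth curves are mapped to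
   smooth curves. *)
Definition smooth_map (E F : lcs) (f : E -> F) : Prop :=
  (forall x, lcs_carrier E x -> lcs_carrier F (f x)) /\
  forall c : R -> E, smooth_curve c -> smooth_curve (f \o c).

(* [differential f x [:: v1; ...; vk]] is d^k f (x)(v1, ..., vk), by
   d^k f (x)(v1, ..., vk) = d(d^(k-1) f (_)(v2, ..., vk))(x)(v1). *)
Definition differential (V : lmodType R[i]) (F : lcs) (f : V -> F) (x : V)
    (vs : seq V) : F :=
  foldr (fun v g y => curve_deriv (fun t : R => g (y + t%:C *: v)) 0) f vs x.

Definition lcs_bounded (E : lcs) (B : set E) : Prop :=
  B `<=` lcs_carrier E /\
  forall p, lcs_seminorms p -> exists C : R, forall f, B f -> p f <= C.

Definition lcsC : lcs :=
  @LCS R (R[i]^o) setT [set (fun z => normc z)].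

End LocallyConvex.
Arguments lcsC {R}.
Arguments smooth_map {R} E F f.
Arguments lcs_bounded {R} E B.

Section SmoothFunctions.
Variables (R : realType) (n : nat).
Local Notation Rn := 'rV[R]_n.

Definition multiindex := {ffun 'I_n -> nat}.
Definition mlength (a : multiindex) : nat := \sum_(i < n) a i.

Definition pderiv (E : lcs R) (i : 'I_n) (f : Rn -> E) : Rn -> E :=
  fun x => curve_deriv (fun h : R => f (x + h *: delta_mx 0 i)) 0.

Definition mderiv (E : lcs R) (a : multiindex) (f : Rn -> E) : Rn -> E :=
  foldr (fun i g => iter (a i) (pderiv i) g) f (enum 'I_n).

(* [f] is smooth on the open set [U] as a map into [E]: all its iterated
   partial derivatives exist in [E] and are continuous on [U]. *)
Definition smooth_on (E : lcs R) (U : set Rn) (f : Rn -> E) : Prop :=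
  (forall x, U x -> lcs_carrier E (f x)) /\
  forall (s : seq 'I_n), let g := foldr (@pderiv E) f s in
  forall x, U x ->
    (forall i, exists l,
       is_curve_deriv (fun h : R => g (x + h *: delta_mx 0 i)) 0 l) /\
    (forall p, lcs_seminorms p -> p (g y - g x) @[y --> x] --> (0 : R)).

(* For [f] smooth near the compact set [K] the set is bounded; its supremum is 0
   when it is empty. *)
Definition sup_seminorm (E : lcs R) (p : E -> R) (K : set Rn) (m : nat)
    (f : Rn -> E) : R :=
  sup [set r | exists x (a : multiindex),
    [/\ K x, (mlength a <= m)%N & r = p (mderiv a f x)]].

(* C^oo(U, E), with uniform convergence of all derivatives on compact sets.  A
   function on [U] is represented by its extension by zero to R^n, so that
   equality of functions on [U] is Leibniz equality. *)
Definition Cinfty (U : set Rn) (E : lcs R) : lcs R :=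
  @LCS R (Rn -> E)
    [set f | smooth_on U f /\ forall x, ~ U x -> f x = 0]
    [set q | exists K (m : nat) p, [/\ well_inside K U, lcs_seminorms p &
       q = sup_seminorm p K m]].

Definition zero_restr (E : lcs R) (V : set Rn) (f : Rn -> E) : Rn -> E :=
  patch (fun=> 0) V f.

Definition fnorm (K : set Rn) (m : nat) (f : Rn -> @lcsC R) : R :=
  sup_seminorm (fun z : @lcsC R => normc z) K m f.

Definition fsupp (phi : Rn -> @lcsC R) : set Rn :=
  closure [set y | phi y != 0].

(* Test functions on [W] are identified with their extensions by zero to R^n. *)
Definition is_test (W : set Rn) (phi : Rn -> @lcsC R) : Prop :=
  [/\ smooth_on setT phi, compact (fsupp phi) & fsupp phi `<=` W].

(* The inductive limit topology of the spaces D_L(W), L compact in W: a seminorm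
   is continuous iff its restriction to each D_L(W) is. *)
Definition testfun (W : set Rn) : lcs R :=
  @LCS R (Rn -> @lcsC R) (is_test W)
    [set p | [/\
      forall phi psi, is_test W phi -> is_test W psi ->
        p (phi + psi) <= p phi + p psi,
      forall (z : R[i]) phi, is_test W phi ->
        p (z *: phi) = normc z * p phi &
      forall L, well_inside L W -> exists (C : R) (m : nat),
        forall phi, is_test W phi -> fsupp phi `<=` L -> p phi <= C * fnorm L m phi]].

(* D_L(W), L compact in W, with its Frechet topology *)
Definition testfun_supp (L W : set Rn) : lcs R :=
  @LCS R (Rn -> @lcsC R) [set phi | is_test W phi /\ fsupp phi `<=` L]
    [set p | exists m : nat, p = fnorm L m].

Definition is_distribution (W : set Rn) (u : (Rn -> @lcsC R) -> R[i]) : Prop :=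
  (forall (z : R[i]) phi psi, is_test W phi -> is_test W psi ->
     u (z *: phi + psi) = z * u phi + u psi) /\
  (forall L, well_inside L W -> exists (C : R) (m : nat),
     forall phi, is_test W phi -> fsupp phi `<=` L ->
       normc (u phi) <= C * fnorm L m phi).

End SmoothFunctions.
Arguments zero_restr {R n} E V f.

Section LebesgueRn.
Variable R : realType.
Local Open Scope ereal_scope.
Local Notation RB := (measurableTypeR R).

Definition cons_tuple (n : nat) (x : RB * n.-tuple RB) : n.+1.-tuple RB :=
  [the n.+1.-tuple RB of x.1 :: x.2].

Lemma measurable_cons_tuple n : measurable_fun setT (@cons_tuple n).
Proof. by apply: measurable_cons. Qed.

Definition measure_cons (n : nat)
    (m : {measure set (n.-tuple RB) -> \bar R}) :
    {measure set (n.+1.-tuple RB) -> \bar R} :=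
  measure_function_pushforward__canonical__measure_function_Measure
    ((@lebesgue_measure R \x^ m) : {measure set (RB * n.-tuple RB) -> \bar R})
    (@measurable_cons_tuple n).

Lemma measure_consE n m : @measure_cons n m =
  pushforward (@lebesgue_measure R \x^ m) (@cons_tuple n) :> (set _ -> _).
Proof. by []. Qed.

Fixpoint lebesgue_tuple (n : nat) : {measure set (n.-tuple RB) -> \bar R} :=
  match n return {measure set (n.-tuple RB) -> \bar R} with
  | 0%N => dirac [tuple]
  | n'.+1 => measure_cons (lebesgue_tuple n')
  end.

Definition integralC (n : nat) (f : 'rV[R]_n -> R[i]) : R[i] :=
  let g (t : n.-tuple RB) : R[i] := f (\row_i (tnth t i : R)) in
  ((\int[lebesgue_tuple n]_t complex.Re (g t))%R
    +i* (\int[lebesgue_tuple n]_t complex.Im (g t))%R)%C.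

End LebesgueRn.

Section Colombeau.
Variables (R : realType) (n : nat).
Local Notation Rn := 'rV[R]_n.
Local Notation Cfun := (Rn -> @lcsC R).
Implicit Types (Omega U K L : set Rn) (B : set Cfun).

(* The derivatives in x are those of the C-valued functions
   x |-> d_y^b vphi(x)(y), for fixed y. *)
Definition vnorm K (c : nat) L (l : nat) (vphi : Rn -> Cfun) : R :=
  sup [set r | exists x (a : multiindex n) y (b : multiindex n),
    [/\ K x, (mlength a <= c)%N, L y, (mlength b <= l)%N &
      r = normc (mderiv a (fun x' => mderiv b (vphi x') y) x)]].

Definition pairing (f : Cfun) (a : multiindex n) (vphi : Rn -> Cfun) (x : Rn) :
    R[i] :=
  integralC (fun y => f y * mderiv a (fun x' => vphi x' y) x).

Definition bnorm K (c : nat) B (vphi : Rn -> Cfun) : R :=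
  sup [set r | exists x (a : multiindex n) f,
    [/\ K x, (mlength a <= c)%N, B f & r = normc (pairing f a vphi x)]].

(* || vphi - vdelta ||_{K,c;B}, where vdelta(x) is the Dirac measure at x *)
Definition dnorm K (c : nat) B (vphi : Rn -> Cfun) : R :=
  sup [set r | exists x (a : multiindex n) f,
    [/\ K x, (mlength a <= c)%N, B f &
      r = normc (pairing f a vphi x - mderiv a f x)]].

(* The variables y_0, ..., y_k come first, then z_0, ..., z_k. *)
Definition yz_args (k : nat) (y z : 'I_k.+1 -> R) (i : 'I_(k.+1 + k.+1)) : R :=
  match fintype.split i with inl j => y j | inr j => z j end.

Definition nonneg_coeffs (N : nat) (lam : mpoly.mpoly N R) : Prop :=
  forall m, 0 <= mpoly.mcoeff m lam.

Definition polyP (k : nat) (lam : mpoly.mpoly k.+1 R) : Prop :=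
  nonneg_coeffs lam.

Definition polyI (k : nat) (lam : mpoly.mpoly (k.+1 + k.+1) R) : Prop :=
  nonneg_coeffs lam /\
  forall y, mpoly.meval (yz_args y (fun=> 0)) lam = 0.

(* Families (R_U)_U; only the values R_U(vphi) for U open in Omega and vphi in
   C^oo(U, D(Omega)) are meaningful. *)
Definition hom_family := set Rn -> (Rn -> Cfun) -> Cfun.

Definition basicB Omega (T : hom_family) : Prop :=
  forall U, open U -> U `<=` Omega ->
    smooth_map (Cinfty U (testfun Omega)) (Cinfty U lcsC) (T U) /\
    forall V, open V -> V `<=` U ->
      forall vphi, lcs_carrier (Cinfty U (testfun Omega)) vphi ->
        zero_restr lcsC V (T U vphi) =
        T V (zero_restr (testfun Omega) V vphi).

Definition iotaB (u : Cfun -> R[i]) : hom_family :=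
  fun U vphi => zero_restr lcsC U (fun x => u (vphi x)).

Definition sigmaB (f : Cfun) : hom_family :=
  fun U _ => zero_restr lcsC U f.

Definition dk (T : hom_family) U (k : nat) (vphi : 'I_k.+1 -> Rn -> Cfun) : Cfun :=
  @differential R (Rn -> Cfun) (Cinfty U lcsC) (T U) (vphi ord0)
    [seq vphi (lift ord0 i) | i <- enum 'I_k].

Definition moderateB Omega (T : hom_family) : Prop :=
  basicB Omega T /\
  forall x, Omega x -> exists U, [/\ open U, U x, U `<=` Omega &
  forall K L, well_inside K U -> well_inside L U -> forall m k : nat,
  exists (c l : nat) (lam : mpoly.mpoly k.+1 R), polyP lam /\
  forall vphi : 'I_k.+1 -> Rn -> Cfun,
    (forall i, lcs_carrier (Cinfty U (testfun_supp L U)) (vphi i)) ->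
    fnorm K m (dk T U vphi) <=
      mpoly.meval (fun i => vnorm K c L l (vphi i)) lam].

Definition negligibleB Omega (T : hom_family) : Prop :=
  basicB Omega T /\
  forall x, Omega x -> exists U, [/\ open U, U x, U `<=` Omega &
  forall K L, well_inside K U -> well_inside L U -> forall m k : nat,
  exists (c l : nat) (lam : mpoly.mpoly (k.+1 + k.+1) R) B,
  [/\ polyI lam, lcs_bounded (Cinfty Omega lcsC) B &
  forall vphi : 'I_k.+1 -> Rn -> Cfun,
    (forall i, lcs_carrier (Cinfty U (testfun_supp L U)) (vphi i)) ->
    fnorm K m (dk T U vphi) <=
      mpoly.meval
        (yz_args (fun i => vnorm K c L l (vphi i))
           (fun i => if i == ord0 then dnorm K c B (vphi i)
                     else bnorm K c B (vphi i))) lam]].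

Definition shift_kernel (phi : Cfun) : Rn -> Cfun := fun x y => phi (y - x).

Definition Uset Omega (phi : Cfun) (x : Rn) : Prop :=
  [/\ is_test setT phi, Omega x & forall y, fsupp phi y -> Omega (x + y)].

(* Maps on U(Omega); the values outside U(Omega) are irrelevant. *)
Definition cmap := Cfun -> Rn -> @lcsC R.

Definition basicBc Omega (T : cmap) : Prop :=
  forall phi, is_test setT phi -> smooth_on [set x | Uset Omega phi x] (T phi).

Definition iotaBc (u : Cfun -> R[i]) : cmap :=
  fun phi x => u (fun y => phi (y - x)).

Definition sigmaBc (f : Cfun) : cmap := fun _ x => f x.

Definition supp_sub K L (phi : Cfun) : Prop :=
  forall x y, K x -> fsupp phi y -> L (x + y).

Definition moderateBc Omega (T : cmap) : Prop :=
  basicBc Omega T /\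
  forall x, Omega x -> exists U, [/\ open U, U x, U `<=` Omega &
  forall K L, well_inside K U -> well_inside L U -> well_inside K L ->
  forall m : nat, exists (c : nat) (lam : mpoly.mpoly 1 R), @polyP 0 lam /\
  forall phi, is_test setT phi -> supp_sub K L phi ->
    fnorm K m (T phi) <= mpoly.meval (fun=> fnorm setT c phi) lam].

Definition negligibleBc Omega (T : cmap) : Prop :=
  basicBc Omega T /\
  forall x, Omega x -> exists U, [/\ open U, U x, U `<=` Omega &
  forall K L, well_inside K U -> well_inside L U -> well_inside K L ->
  forall m : nat, exists (c : nat) (lam : mpoly.mpoly (1 + 1) R) B,
  [/\ @polyI 0 lam, lcs_bounded (Cinfty U lcsC) B &
  forall phi, is_test setT phi -> supp_sub K L phi ->
    fnorm K m (T phi) <=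
      mpoly.meval
        (@yz_args 0 (fun=> fnorm setT c phi)
           (fun=> dnorm K c B (shift_kernel phi))) lam]].

(* R~(phi, x) = R(vphi)(x), for a chosen vphi in C^oo(Omega, D(Omega))
   that agrees with phi^star near x; for R in B(Omega) the value does not depend
   on the choice, see [tildeBE]. *)
Definition tildeB Omega (T : hom_family) : cmap := fun phi x =>
  T Omega (xget 0 [set vphi |
    lcs_carrier (Cinfty Omega (testfun Omega)) vphi /\
    \forall x' \near x, vphi x' = shift_kernel phi x']) x.

Lemma tildeBE Omega (T : hom_family) phi x vphi :
  open Omega -> basicB Omega T -> Omega x ->
  lcs_carrier (Cinfty Omega (testfun Omega)) vphi ->
  (\forall x' \near x, vphi x' = shift_kernel phi x') ->
  tildeB Omega T phi x = T Omega vphi x.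
Proof.
move=> oO bT Ox cv nv; rewrite /tildeB.
set P := [set v | _]; have Pv : P vphi by split.
have [cw nw] : P (xget 0 P) by apply: xgetPex; exists vphi.
set w := xget 0 P in cw nw *.
have nE : \forall x' \near x, vphi x' = w x' /\ Omega x'.
  near=> x'; split; last by near: x'; exact: open_nbhs_nbhs.
  by rewrite (near nv x')// (near nw x').
have [V [oV Vx] VE] : exists2 V : set Rn, open_nbhs x V &
    V `<=` [set x' | vphi x' = w x' /\ Omega x'].
  by move: nE; rewrite -nbhs_nearE nbhsE => -[V ? ?]; exists V.
have VO : V `<=` Omega by move=> y /VE[].
have [_ resT] := bT Omega oO (@subset_refl _ _).
have rE : zero_restr (testfun Omega) V vphi =
          zero_restr (testfun Omega) V w.
  by apply/funext => y; rewrite /zero_restr /patch; case: ifPn => // /set_mem /VE[].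
have : zero_restr lcsC V (T Omega vphi) x =
       zero_restr lcsC V (T Omega w) x.
  by rewrite !resT// rE.
by rewrite /zero_restr /patch mem_set.
Unshelve. all: by end_near. Qed.

End Colombeau.

(* Main.v *)
Require Import Defs.
From mathcomp Require Import all_boot all_order all_algebra.
From mathcomp Require Import all_classical all_reals all_analysis.
From mathcomp.real_closed Require Import complex.
From mathcomp Require mpoly.
From mathcomp Require Import ring lra.
Import numFieldNormedType.Exports.
Import Order.TTheory GRing.Theory Num.Theory.

Set Implicit Arguments.
Unset Strict Implicit.
Unset Printing Implicit Defensive.

Local Open Scope classical_set_scope.
Local Open Scope ring_scope.

Local Notation normc := ComplexField.Normc.normc.

(** Near a point [x0] with [x0 + supp phi] in [Omega], the translates
    [phi (y - x)] are cut off in the variable [x]: with a bump [chi] equal to 1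
    near [x0] and supported so close to it that [supp chi + supp phi] lies in a
    compact [L] contained in [Omega], the kernel [chi x * phi (y - x)]
    ([cutoff_kernel]) belongs to [C^oo(Omega, D(Omega))] and agrees with
    [phi^star] near [x0]. Hence [R~(phi, _)] is locally the smooth function [R]
    applied to this kernel, and the values of [R~] for [iota u] and [sigma f] can
    be read off.

    For the estimates, let [K] and [L] be compact in [U] with
    [K + supp phi] in [L]. Choosing the bump around all of [K] gives one kernel
    for which [R~(phi, _)] and [R] agree near [K] ([tilde_local_kernel]); its
    values are supported in a compact neighbourhood [L'] of [L] in [U]. The
    estimate for [R] with [k = 0] and [L'] in place of [L] then bounds the
    derivatives of [R~(phi, _)] on [K]. Over [K] the derivatives of the kernel in
    [x] and [y], of orders up to [c] and [l], are derivatives of [phi] of order up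
    to [c + l], so its norm is at most the norm of [phi] of order [c + l]
    ([vnorm_le_fnorm]); polynomials with nonnegative coefficients are monotone.
    For negligibility, the bounded subset [B] of [C^oo(Omega)] is restricted to
    [U], which changes none of the pairings over [K]; passing from order [c] to
    [c + l] there only enlarges the supremum, once this is known to be finite
    ([dnorm_le]).

    What has to be built for this is the smoothness of the kernels as maps into
    spaces of test functions ([kernel_span_smooth_on]), and bump functions
    ([bump_exists]). For the former, the linear span of the kernels is stable
    under differentiation in [x], and Taylor's formula holds in it uniformly in
    [y], for all derivatives in [y]; the order of derivatives has to be changed on
    the way, by Schwarz's theorem ([pderiv_comm]). *)

(** * The modulus on the complex numbers *)

Section ComplexModulus.
Variable R : realType.
Implicit Types z w : R[i].

Lemma normc_ge0 z : 0 <= normc z.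
Proof. by case: z => a b; exact: sqrtr_ge0. Qed.

Lemma normr_Re_le z : `|complex.Re z| <= normc z.
Proof.
case: z => a b /=; rewrite -sqrtr_sqr ler_sqrt ?addr_ge0 ?sqr_ge0//.
by rewrite lerDl sqr_ge0.
Qed.

Lemma normr_Im_le z : `|complex.Im z| <= normc z.
Proof.
case: z => a b /=; rewrite -sqrtr_sqr ler_sqrt ?addr_ge0 ?sqr_ge0//.
by rewrite lerDr sqr_ge0.
Qed.

Lemma normc_le z : normc z <= `|complex.Re z| + `|complex.Im z|.
Proof.
case: z => a b /=; rewrite -[leRHS]ger0_norm ?addr_ge0//.
rewrite -[leRHS]sqrtr_sqr ler_sqrt ?sqr_ge0// sqrrD !real_normK ?num_real//.
by rewrite lerD2r lerDl mulrn_wge0// mulr_ge0.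
Qed.

Lemma normcN z : normc (- z) = normc z.
Proof. exact: complex.normcN. Qed.

Lemma normcM z w : normc (z * w) = normc z * normc w.
Proof. exact: ComplexField.Normc.normcM. Qed.

Lemma normcD z w : normc (z + w) <= normc z + normc w.
Proof. exact: le_normcD. Qed.

Lemma normcB z w : normc (z - w) <= normc z + normc w.
Proof. by rewrite -(normcN w); exact: normcD. Qed.

Lemma normc_real (a : R) : normc (a%:C)%C = `|a|.
Proof. by rewrite /= expr0n addr0 sqrtr_sqr. Qed.

Lemma normc0 : normc (0 : R[i]) = 0.
Proof. by rewrite /= expr0n addr0 sqrtr0. Qed.

Lemma Re_add z w : complex.Re (z + w) = complex.Re z + complex.Re w.
Proof. by case: z w => [? ?] []. Qed.

Lemma Im_add z w : complex.Im (z + w) = complex.Im z + complex.Im w.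
Proof. by case: z w => [? ?] []. Qed.

Lemma Re_opp z : complex.Re (- z) = - complex.Re z.
Proof. by case: z. Qed.

Lemma Im_opp z : complex.Im (- z) = - complex.Im z.
Proof. by case: z. Qed.

Lemma Re_mul z w : complex.Re (z * w) =
  complex.Re z * complex.Re w - complex.Im z * complex.Im w.
Proof. by case: z w => [? ?] []. Qed.

Lemma Im_mul z w : complex.Im (z * w) =
  complex.Re z * complex.Im w + complex.Im z * complex.Re w.
Proof. by case: z w => [? ?] []. Qed.

Definition ReImE := (Re_add, Im_add, Re_opp, Im_opp, Re_mul, Im_mul).

Lemma complex_eqP z w : complex.Re z = complex.Re w ->
  complex.Im z = complex.Im w -> z = w.
Proof. by case: z w => [a b] [c d] /= -> ->. Qed.

Lemma cvg_normc T (F : set_system T) {FF : Filter F} (f : T -> R[i]) :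
  normc (f h) @[h --> F] --> (0 : R) <->
  complex.Re (f h) @[h --> F] --> (0 : R) /\
  complex.Im (f h) @[h --> F] --> (0 : R).
Proof.
split=> [f0|[/cvg_norm r0 /cvg_norm i0]].
  have g0 : (- normc (f h)) @[h --> F] --> (0 : R).
    by rewrite -[X in _ --> X]oppr0; exact: cvgN.
  split; apply: (squeeze_cvgr _ g0 f0); apply: nearW => h;
    rewrite -ler_norml ?normr_Re_le ?normr_Im_le//.
rewrite !normr0 in r0 i0.
have s0 : (`|complex.Re (f h)| + `|complex.Im (f h)|) @[h --> F] --> (0 : R).
  by rewrite -[X in _ --> X]addr0; exact: cvgD.
apply: (squeeze_cvgr _ (cvg_cst (0 : R)) s0).
by apply: nearW => h; rewrite normc_ge0 normc_le.
Qed.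

End ComplexModulus.

Lemma cvg_ext (R : realType) T (F : set_system T) (f g : T -> R) (l : R) :
  f =1 g -> f h @[h --> F] --> l -> g h @[h --> F] --> l.
Proof. by move=> /funext ->. Qed.

(** * Differentiable curves in the complex plane *)

Section ComplexCurves.
Variable R : realType.
Local Notation cd := (@is_curve_deriv R lcsC).
Implicit Types (c : R -> R[i]) (t : R) (l : R[i]).

Lemma is_derive1P (f : R -> R) (t l : R) : is_derive t 1 f l <->
  (h^-1 * (f (t + h) - f t) - l) @[h --> 0^'] --> (0 : R).
Proof.
have E h : h^-1 *: ((f \o shift t) (h *: 1) - f t) = h^-1 * (f (t + h) - f t).
  by rewrite /= /GRing.scale /= mulr1 (addrC h).
split=> [[dv <-]|H].
  have K : (h^-1 *: ((f \o shift t) (h *: 1) - f t)) @[h --> 0^'] --> 'D_1 f t.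
    exact: dv.
  have := cvgB K (cvg_cst ('D_1 f t)); rewrite subrr => /(_ _ _) K'.
  by apply: (cvg_ext _ K') => h; rewrite -E.
have K : (h^-1 *: ((f \o shift t) (h *: 1) - f t)) @[h --> 0^'] --> l.
  have := cvgD H (cvg_cst l); rewrite add0r => /(_ _ _) K'.
  by apply: (cvg_ext _ K') => h; rewrite E /= subrK.
apply: DeriveDef; first by apply/cvg_ex; exists l; exact: K.
exact: cvg_lim K.
Qed.

Lemma is_derive1D (f g : R -> R) (t a b : R) :
  is_derive t 1 f a -> is_derive t 1 g b ->
  is_derive t 1 (fun s => f s + g s) (a + b).
Proof. by move=> fa gb; exact: is_deriveD. Qed.

Lemma is_derive1M (f g : R -> R) (t a b : R) :
  is_derive t 1 f a -> is_derive t 1 g b ->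
  is_derive t 1 (fun s => f s * g s) (a * g t + f t * b).
Proof.
move=> fa gb; have H : is_derive t 1 (f * g) _ := is_deriveM fa gb.
by apply: (is_derive_eq H); rewrite /GRing.scale /= addrC mulrC (mulrC (f t)).
Qed.

(** Differentiability of a complex curve is that of its real and imaginary
    parts, so the calculus of real functions of one variable applies. *)
Lemma curve_derivP c t l : cd c t l <->
  is_derive t 1 (fun s => complex.Re (c s)) (complex.Re l) /\
  is_derive t 1 (fun s => complex.Im (c s)) (complex.Im l).
Proof.
have Eq h : complex.Re ((h^-1)%:C%C *: (c (t + h) - c t) - l) =
      h^-1 * (complex.Re (c (t + h)) - complex.Re (c t)) - complex.Re l /\
    complex.Im ((h^-1)%:C%C *: (c (t + h) - c t) - l) =
      h^-1 * (complex.Im (c (t + h)) - complex.Im (c t)) - complex.Im l.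
  by rewrite /GRing.scale /= !ReImE/= !mul0r subr0 addr0.
rewrite !is_derive1P; split.
  move=> [_ /(_ _ erefl)] /cvg_normc[r i]; split.
    by apply: (cvg_ext _ r) => h; rewrite -(Eq h).1.
  by apply: (cvg_ext _ i) => h; rewrite -(Eq h).2.
move=> [r i]; split=> // _ ->; apply/cvg_normc; split.
  by apply: (cvg_ext _ r) => h; rewrite (Eq h).1.
by apply: (cvg_ext _ i) => h; rewrite (Eq h).2.
Qed.

Lemma curve_deriv_unique c t l l' : cd c t l -> cd c t l' -> l = l'.
Proof.
move=> /curve_derivP[[_ r] [_ i]] /curve_derivP[[_ r'] [_ i']].
by apply: complex_eqP; rewrite -?r -?i.
Qed.

Lemma curve_derivE c t l : cd c t l -> @curve_deriv R lcsC c t = l.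
Proof.
move=> cl; apply: (@curve_deriv_unique c t) => //.
by rewrite /curve_deriv; apply: (@xgetPex _ 0 [set l | cd c t l]); exists l.
Qed.

Lemma curve_deriv_cst a t : cd (fun=> a) t 0.
Proof. by apply/curve_derivP; split; exact: is_derive_cst. Qed.

Lemma curve_derivD c d t l m : cd c t l -> cd d t m ->
  cd (fun s => c s + d s) t (l + m).
Proof.
move=> /curve_derivP[cr ci] /curve_derivP[dr di].
apply/curve_derivP; rewrite !ReImE; split.
  by under eq_fun do rewrite ReImE; exact: is_derive1D.
by under eq_fun do rewrite ReImE; exact: is_derive1D.
Qed.

Lemma curve_derivM c d t l m : cd c t l -> cd d t m ->
  cd (fun s => c s * d s) t (l * d t + c t * m).
Proof.
move=> /curve_derivP[cr ci] /curve_derivP[dr di].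
have N (f : R -> R) (a : R) : is_derive t 1 f a ->
    is_derive t 1 (fun s => - f s) (- a) by move=> fa; exact: is_deriveN.
apply/curve_derivP; rewrite !ReImE; split.
  under eq_fun do rewrite Re_mul.
  have H := is_derive1D (is_derive1M cr dr) (N _ _ (is_derive1M ci di)).
  by apply: (is_derive_eq H); ring.
under eq_fun do rewrite Im_mul.
have H := is_derive1D (is_derive1M cr di) (is_derive1M ci dr).
by apply: (is_derive_eq H); ring.
Qed.

Lemma is_derive_affine (f : R -> R) (a b t l : R) :
  is_derive (a + b * t) 1 f l -> is_derive t 1 (fun s => f (a + b * s)) (b * l).
Proof.
move=> fl; rewrite mulrC.
apply: (@is_derive1_comp _ f (fun s => a + b * s) t l b fl).
have Z : is_derive t 1 (fun s => b * s) b.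
  have H : is_derive t 1 (b *: id) _ := is_deriveZ b (is_derive_id t (1 : R)).
  by apply: (is_derive_eq H); rewrite /GRing.scale /= mulr1.
have := is_derive1D (is_derive_cst a t (1 : R)) Z.
by rewrite add0r.
Qed.

Lemma curve_deriv_affine c (a b : R) t l : cd c (a + b * t) l ->
  cd (fun s => c (a + b * s)) t ((b%:C)%C * l).
Proof.
move=> /curve_derivP[r i]; apply/curve_derivP.
rewrite !ReImE/= mul0r subr0 mul0r addr0.
split.
  exact: (@is_derive_affine (fun s => complex.Re (c s))).
exact: (@is_derive_affine (fun s => complex.Im (c s))).
Qed.

Lemma near_eq_curve_deriv c d t l :
  (\forall h \near (0 : R), c (t + h) = d (t + h)) -> cd c t l -> cd d t l.
Proof.
move=> cd0 [_ /(_ _ erefl) cl]; split=> // _ ->.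
have ct : c t = d t by have := nbhs_singleton cd0; rewrite addr0.
apply: cvg_trans cl; apply: near_eq_cvg.
apply: nbhs_dnbhs; near=> h.
by rewrite (near cd0 h)// ct.
Unshelve. all: by end_near. Qed.

(** The mean value theorem, with the intermediate point controlled only in
   absolute value, so that the sign of [h] is irrelevant. *)
Lemma mvt0 (u v : R -> R) : (forall t, is_derive t 1 u (v t)) ->
  forall h, exists2 s, `|s| <= `|h| & u h - u 0 = v s * h.
Proof.
move=> uv h.
have cu : continuous u.
  move=> t; apply/differentiable_continuous/derivable1_diffP.
  exact: (@ex_derive _ _ _ _ _ _ _ (uv t)).
have [h0|h0] := leP 0 h.
  have [|s sh ->] := @MVT_segment _ u v 0 h h0 (fun t _ => uv t).
    exact: continuous_subspaceT.
  rewrite subr0; exists s => //; move: sh; rewrite in_itv/= => /andP[s0 sh].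
  by rewrite !ger0_norm.
have [|s sh E] := @MVT_segment _ u v h 0 (ltW h0) (fun t _ => uv t).
  exact: continuous_subspaceT.
exists s; last by rewrite -opprB E sub0r mulrN opprK.
move: sh; rewrite in_itv/= => /andP[s0 sh].
by rewrite (ler0_norm sh) (ltr0_norm h0) lerN2.
Qed.

(** For a complex curve the mean value theorem survives only as an inequality;
    the two real components have different intermediate points, which costs
    the factor 2. *)
Lemma curve_mvt c d (M : R) : (forall t, cd c t (d t)) ->
  (forall t, normc (d t) <= M) ->
  forall h, normc (c h - c 0) <= 2 * M * `|h|.
Proof.
move=> cdd dM h.
have cr t := (@curve_derivP c t (d t)).1 (cdd t).
have [s _ sE] := mvt0 (fun t => (cr t).1) h.
have [r _ rE] := mvt0 (fun t => (cr t).2) h.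
apply: (le_trans (normc_le _)); rewrite !ReImE sE rE !normrM -mulrDl ler_wpM2r//.
rewrite mulr2n mulrDl !mul1r lerD//.
  exact: (le_trans (normr_Re_le _) (dM s)).
exact: (le_trans (normr_Im_le _) (dM r)).
Qed.

(** The mean value theorem for [c], then for its derivative [d] between [0] and
    the intermediate point. *)
Lemma curve_taylor c d e (M : R) : (forall t, cd c t (d t)) ->
  (forall t, cd d t (e t)) -> (forall t, normc (e t) <= M) ->
  forall h, normc (c h - c 0 - (h%:C)%C * d 0) <= 2 * M * `|h| ^+ 2.
Proof.
move=> cdd dde eM h.
have cr t := (@curve_derivP c t (d t)).1 (cdd t).
have dr t := (@curve_derivP d t (e t)).1 (dde t).
have [s sh sE] := mvt0 (fun t => (cr t).1) h.
have [r rh rE] := mvt0 (fun t => (cr t).2) h.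
have [s' _ s'E] := mvt0 (fun t => (dr t).1) s.
have [r' _ r'E] := mvt0 (fun t => (dr t).2) r.
apply: (le_trans (normc_le _)); rewrite !ReImE/= mul0r subr0 mul0r addr0 sE rE.
rewrite !(mulrC h) -!mulrBl s'E r'E !normrM expr2 mulrA -mulrDl ler_wpM2r//.
rewrite mulr2n mulrDl !mul1r mulrDl; apply: lerD; apply: ler_pM => //.
  exact: (le_trans (normr_Re_le _) (eM s')).
exact: (le_trans (normr_Im_le _) (eM r')).
Qed.

End ComplexCurves.

(** * Partial derivatives and smooth functions *)

Section PartialDerivatives.
Variables (R : realType) (n : nat).
Local Notation Rn := 'rV[R]_n.
Local Notation C := (@lcsC R).
Local Notation pd := (@pderiv R n C).
Local Notation sm := (@smooth_on R n C).
Local Notation e_ i := (delta_mx 0 i : Rn).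
Implicit Types (f g : Rn -> C) (i : 'I_n) (x y : Rn) (s : seq 'I_n).

Definition has_pderiv f i x (l : C) :=
  is_curve_deriv (fun h : R => f (x + h *: e_ i) : C) 0 l.

Definition pderivs s f : Rn -> C := foldr pd f s.

Lemma pderivs_rcons s i f : pderivs (rcons s i) f = pderivs s (pd i f).
Proof. by rewrite /pderivs foldr_rcons. Qed.

Lemma pderivs_cat s t f : pderivs (s ++ t) f = pderivs s (pderivs t f).
Proof. by rewrite /pderivs foldr_cat. Qed.

Lemma has_pderivE f i x l : has_pderiv f i x l -> pd i f x = l.
Proof. exact: curve_derivE. Qed.

(** Turns partial derivatives into derivatives of a curve at every parameter, to
    which the mean value theorem applies. *)
Lemma has_pderiv_line f i x t l : has_pderiv f i (x + t *: e_ i) l <->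
  is_curve_deriv (fun h : R => f (x + h *: e_ i) : C) t l.
Proof.
split=> H.
  have : is_curve_deriv (fun h : R => f (x + t *: e_ i + h *: e_ i) : C)
    (- t + 1 * t) l by rewrite mul1r addNr.
  move=> /curve_deriv_affine; rewrite mul1r; congr is_curve_deriv.
  by apply/funext => h; rewrite -addrA -scalerDl mul1r addrA subrr add0r.
have : is_curve_deriv (fun h : R => f (x + h *: e_ i) : C) (t + 1 * 0) l.
  by rewrite mulr0 addr0.
move=> /curve_deriv_affine; rewrite mul1r; congr is_curve_deriv.
by apply/funext => h; rewrite -addrA -scalerDl mul1r.
Qed.

Lemma has_pderiv_cst a i x : has_pderiv (fun=> a) i x 0.
Proof. exact: curve_deriv_cst. Qed.

Lemma has_pderivD f g i x l m : has_pderiv f i x l -> has_pderiv g i x m ->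
  has_pderiv (fun y => f y + g y) i x (l + m).
Proof. exact: curve_derivD. Qed.

Lemma has_pderivZ (a : R[i]) f i x l : has_pderiv f i x l ->
  has_pderiv (fun y => (a * f y : R[i])) i x (a * l).
Proof.
move=> H; rewrite -[a * l]add0r -[X in X + _](mul0r (f (x + 0 *: e_ i))).
exact: (curve_derivM (curve_deriv_cst a 0) H).
Qed.

Lemma has_pderiv_shift f i x y l : has_pderiv f i (x - y) l ->
  has_pderiv (fun z => f (z - y)) i x l.
Proof.
by rewrite /has_pderiv; congr is_curve_deriv; apply/funext => h; rewrite addrAC.
Qed.

Lemma has_pderiv_reflect f i x y l : has_pderiv f i (y - x) l ->
  has_pderiv (fun z => f (y - z)) i x (- l).
Proof.
move=> H; have {H} : is_curve_deriv (fun h : R => f (y - x + h *: e_ i) : C)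
    (0 + (-1) * 0) l by rewrite mulr0 addr0.
move=> /curve_deriv_affine H.
have -> : - l = ((-1)%:C)%C * l by rewrite rmorphN rmorph1 mulN1r.
move: H; rewrite /has_pderiv; congr is_curve_deriv; apply/funext => h.
by rewrite add0r mulN1r scaleNr opprD addrA.
Qed.

Section Locality.

Lemma near_line x i (P : Rn -> Prop) : (\forall y \near x, P y) ->
  \forall h \near (0 : R), P (x + h *: e_ i).
Proof.
move=> Px; have : (x + h *: e_ i) @[h --> (0 : R)] --> x.
  rewrite -[X in _ --> X]addr0 -[X in _ + X](scale0r (e_ i)).
  by apply: cvgD; [exact: cvg_cst|apply: cvgZl; exact: cvg_id].
by apply.
Qed.

Lemma near_eq_has_pderiv f g i x l : (\forall y \near x, f y = g y) ->
  has_pderiv f i x l -> has_pderiv g i x l.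
Proof.
move=> fg; apply: near_eq_curve_deriv.
by have := near_line i fg; apply: filterS => h; rewrite add0r.
Qed.

(** The derivative is the value of a choice operator on the set of all
    derivatives, so equality holds even where none exists. *)
Lemma near_eq_pderiv f g i x : (\forall y \near x, f y = g y) ->
  pd i f x = pd i g x.
Proof.
move=> fg; have gf : \forall y \near x, g y = f y by apply: filterS fg.
have E : has_pderiv f i x = has_pderiv g i x.
  by apply/seteqP; split=> l; exact: near_eq_has_pderiv.
exact: (congr1 (fun P : set C => xget 0 [set l | P l]) E).
Qed.

Lemma pderiv_shift f i y : pd i (fun x => f (x - y)) = fun x => pd i f (x - y).
Proof.
apply/funext => x; rewrite /pderiv.
have -> : (fun h : R => f (x + h *: e_ i - y)) =
          (fun h : R => f (x - y + h *: e_ i)).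
  by apply/funext => h; rewrite addrAC.
by [].
Qed.

Lemma eq_on_pderivs N f g s : open N -> (forall x, N x -> f x = g x) ->
  forall x, N x -> pderivs s f x = pderivs s g x.
Proof.
move=> oN fg; elim: s => [|i s IH] x Nx; first exact: fg.
apply: near_eq_pderiv.
have := open_nbhs_nbhs (conj oN Nx); apply: filterS; exact: IH.
Qed.

Lemma eq_on_mderiv N f g a : open N -> (forall x, N x -> f x = g x) ->
  forall x, N x -> mderiv a f x = mderiv a g x.
Proof.
move=> oN fg; rewrite /mderiv; elim: (enum 'I_n) => [|i s IH]; first exact: fg.
move=> /=; elim: (a i) => [|k IHk] x Nx; first exact: IH.
apply: near_eq_pderiv.
have := open_nbhs_nbhs (conj oN Nx); apply: filterS; exact: IHk.
Qed.

End Locality.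

Section MultiIndices.

(** The indices in the order in which [mderiv a] differentiates. *)
Definition index_seq (a : multiindex n) : seq 'I_n :=
  flatten [seq nseq (a i) i | i <- enum 'I_n].

Lemma size_index_seq a : size (index_seq a) = mlength a.
Proof.
rewrite /index_seq size_flatten /shape -map_comp sumnE big_map big_enum /=.
by apply: eq_bigr => i _; rewrite size_nseq.
Qed.

Lemma mderivE a f : mderiv a f = pderivs (index_seq a) f.
Proof.
rewrite /mderiv /index_seq; elim: (enum 'I_n) => [|i s IH]; first by [].
rewrite /= IH pderivs_cat; elim: (a i) => [|k IHk]; first by [].
by rewrite /= IHk.
Qed.

Lemma perm_index_seq s :
  exists2 a, mlength a = size s & perm_eq s (index_seq a).
Proof.
pose a : multiindex n := [ffun i => count_mem i s].
suff ps : perm_eq s (index_seq a).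
  by exists a => //; rewrite -size_index_seq (perm_size ps).
apply/allP => i _ /=; apply/eqP.
rewrite /index_seq count_flatten -map_comp sumnE big_map big_enum /=.
rewrite (bigD1 i)//= count_nseq /= eqxx mul1n ffunE big1 ?addn0// => j ji.
by rewrite count_nseq /= (negbTE ji) mul0n.
Qed.

End MultiIndices.

Section SmoothOn.
Variable U : set Rn.

Lemma smooth_has_pderiv f i x : sm U f -> U x ->
  has_pderiv f i x (pd i f x).
Proof.
move=> [_ /(_ [::])/= sf] Ux; have [/(_ i)[l fl] _] := sf _ Ux.
by rewrite (has_pderivE fl).
Qed.

Lemma smooth_pderiv f i : sm U f -> sm U (pd i f).
Proof.
by move=> [_ sf]; split=> // s; have := sf (rcons s i); rewrite foldr_rcons.
Qed.

Lemma smooth_pderivs f s : sm U f -> sm U (pderivs s f).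
Proof. by move=> sf; elim: s => [|i s IH]; [exact: sf|exact: smooth_pderiv]. Qed.

Lemma smooth_cvg f x : sm U f -> U x ->
  normc (f y - f x) @[y --> x] --> (0 : R).
Proof. by move=> [_ /(_ [::])/= sf] Ux; have [_ /(_ _ erefl)] := sf _ Ux. Qed.

Lemma smooth_sub (V : set Rn) f : V `<=` U -> sm U f -> sm V f.
Proof. by move=> VU [_ sf]; split=> // s g x Vx; exact: sf _ _ (VU _ Vx). Qed.

Lemma eq_on_smooth f g : open U -> (forall x, U x -> f x = g x) ->
  sm U f -> sm U g.
Proof.
move=> oU fg [_ sf]; split=> // s h x Ux.
have fgs := eq_on_pderivs s oU fg.
have [sf1 sf2] := sf s x Ux; split.
  move=> i; have [l fl] := sf1 i; exists l; apply: near_eq_has_pderiv fl.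
  have := open_nbhs_nbhs (conj oU Ux); apply: filterS; exact: fgs.
move=> p hp; have E : \forall y \near x,
    p (pderivs s f y - pderivs s f x) = p (h y - h x).
  have := open_nbhs_nbhs (conj oU Ux); apply: filterS => y Uy.
  by rewrite /h -!/(pderivs _ _) !fgs.
exact: (cvg_trans (near_eq_cvg E) (sf2 p hp)).
Qed.

(** By induction on the order, through the finitely many partial derivatives of
    [f]; a single continuous function is bounded on [K] by a covering argument. *)
Lemma smooth_bounded K f m : compact K -> K `<=` U -> sm U f ->
  exists2 M, 0 <= M &
    forall s x, (size s <= m)%N -> K x -> normc (pderivs s f x) <= M.
Proof.
move=> cK KU; elim: m f => [|m IH] f sf.
  have : \forall M \near +oo, K `<=` [set x | normc (f x) <= M].
    apply: ((compact_near_coveringP K).1 cK _ _ (fun M x => normc (f x) <= M)).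
    move=> x Kx; have /cvgrPdist_lt/(_ 1 ltr01) := smooth_cvg sf (KU _ Kx).
    move=> fx; exists ([set y | normc (f y - f x) < 1],
      [set M : R | 1 + normc (f x) <= M]); first split=> /=.
    - apply: filterS fx => y /=.
      by rewrite sub0r normrN ger0_norm ?normc_ge0.
    - by apply: nbhs_pinfty_ge; rewrite num_real.
    move=> [y M] [/= fy fM]; rewrite -(subrK (f x) (f y)).
    apply: (le_trans (normcD _ _)); apply: le_trans fM.
    by rewrite lerD2r ltW.
  move=> KM; near (pinfty_nbhs R) => M; exists M; first by near: M; exact: nbhs_pinfty_ge.
  move=> [|i s] x sm Kx; last by [].
  by have /(_ _) := near KM M; apply=> //; near: M.
have [M0 M00 HM0] := IH f sf.
have /choice[M HM] i : exists M : R, 0 <= M /\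
    forall s x, (size s <= m)%N -> K x -> normc (pderivs s (pd i f) x) <= M.
  by have [M ? ?] := IH _ (smooth_pderiv i sf); exists M.
exists (M0 + \sum_i M i); first by rewrite addr_ge0// sumr_ge0// => i _; exact: (HM i).1.
move=> s x; case/lastP: s => [_ Kx|s i].
  rewrite -[leLHS]addr0; apply: lerD; first exact: (HM0 [::]).
  by rewrite sumr_ge0// => i _; exact: (HM i).1.
rewrite size_rcons ltnS pderivs_rcons => sm Kx.
rewrite -[leLHS]add0r; apply: lerD => //; rewrite (bigD1 i)//= -[leLHS]addr0.
apply: lerD; first exact: (HM i).2.
by rewrite sumr_ge0// => j _; exact: (HM j).1.
Unshelve. all: by end_near. Qed.

End SmoothOn.

(** Global smoothness by coinduction: it suffices to exhibit a class of
    continuous functions that contains the partial derivatives of its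
    members. *)
Lemma smooth_coind (P : (Rn -> C) -> Prop) :
  (forall f, P f -> (forall x, normc (f y - f x) @[y --> x] --> (0 : R)) /\
     forall i, exists2 g, P g & forall x, has_pderiv f i x (g x)) ->
  forall f, P f -> sm setT f.
Proof.
move=> HP f Pf; split=> // s /=.
have : P (pderivs s f).
  elim: s => [|i s Ps]; first exact: Pf.
  have [_ /(_ i)[g Pg gE]] := HP _ Ps.
  have -> : pderivs (i :: s) f = g by apply/funext => x; exact: has_pderivE.
  exact: Pg.
move=> /HP[cs ds] x _; split=> [i|_ ->]; last exact: cs.
by have [g _ gE] := ds i; exists (g x); exact: gE.
Qed.

Lemma cvg_normcD (f g : Rn -> C) x : normc (f y - f x) @[y --> x] --> (0 : R) ->
  normc (g y - g x) @[y --> x] --> (0 : R) ->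
  normc (f y + g y - (f x + g x)) @[y --> x] --> (0 : R).
Proof.
move=> f0 g0.
have s0 : (normc (f y - f x) + normc (g y - g x)) @[y --> x] --> (0 : R).
  have := cvgD f0 g0; rewrite addr0 => /(_ _) K; exact: K.
apply: (squeeze_cvgr _ (cvg_cst (0 : R)) s0); apply: nearW => y.
rewrite normc_ge0 /= (_ : f y + g y - _ = (f y - f x) + (g y - g x)) ?normcD//.
by rewrite opprD addrACA.
Qed.

Lemma cvg_normcZ (a : R[i]) (f : Rn -> C) x :
  normc (f y - f x) @[y --> x] --> (0 : R) ->
  normc (a * f y - a * f x) @[y --> x] --> (0 : R).
Proof.
move=> f0; have := cvgM (cvg_cst (normc a)) f0; rewrite mulr0 => /(_ _ _) K.
apply: (cvg_ext _ K) => y; by rewrite /= -normcM mulrBr.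
Qed.

Lemma smoothT_lin (a : R[i]) f g : sm setT f -> sm setT g ->
  sm setT (fun x => (a * f x + g x : R[i])).
Proof.
move=> sf sg; apply: (@smooth_coind (fun h => exists f g, [/\ sm setT f,
  sm setT g & h = fun x => (a * f x + g x : R[i])])); last by exists f, g.
move=> _ [{}f [{}g [{}sf {}sg ->]]]; split.
  move=> x; apply: cvg_normcD; last exact: (smooth_cvg sg).
  by apply: cvg_normcZ; exact: (smooth_cvg sf).
move=> i; exists (fun x => (a * pd i f x + pd i g x : R[i])).
  by exists (pd i f), (pd i g); split => //; exact: smooth_pderiv.
move=> x; apply: has_pderivD; last exact: (smooth_has_pderiv _ sg).
by apply: has_pderivZ; exact: (smooth_has_pderiv _ sf).
Qed.

Lemma pderivs_lin (a : R[i]) f g s : sm setT f -> sm setT g ->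
  pderivs s (fun x => (a * f x + g x : R[i])) =
  fun x => (a * pderivs s f x + pderivs s g x : R[i]).
Proof.
move=> sf sg; elim: s => [|i s IH]; first by [].
rewrite [LHS]/= -/(pderivs _ _) IH; apply/funext => x; apply: has_pderivE.
apply: has_pderivD.
  by apply: has_pderivZ; apply: (smooth_has_pderiv _ (smooth_pderivs s sf)).
exact: (smooth_has_pderiv _ (smooth_pderivs s sg)).
Qed.

Lemma pderivs0 s : pderivs s (fun=> 0) = fun=> 0.
Proof.
elim: s => [|i s IH]; first by [].
rewrite [LHS]/= -/(pderivs _ _) IH; apply/funext => x; apply: has_pderivE; exact: has_pderiv_cst.
Qed.

Lemma smoothT0 : sm setT (fun _ : Rn => 0 : C).
Proof.
apply: (@smooth_coind (fun h => h = fun=> 0)) => // _ ->; split=> [x|i].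
  have FF : Filter (nbhs x) by typeclasses eauto.
  have K := @cvg_cst _ (0 : R) _ (nbhs x) FF.
  by apply: (cvg_ext _ K) => y; rewrite subrr; apply/esym; exact: normc0.
by exists (fun=> 0) => // x; exact: has_pderiv_cst.
Qed.

Lemma smoothTZ (a : R[i]) f : sm setT f ->
  sm setT (fun x => (a * f x : R[i])).
Proof.
move=> sf; have := smoothT_lin a sf smoothT0; congr smooth_on.
by apply/funext => x; rewrite addr0.
Qed.

Lemma pderivsZ (a : R[i]) f s : sm setT f ->
  pderivs s (fun x => (a * f x : R[i])) = fun x => (a * pderivs s f x : R[i]).
Proof.
move=> sf; have := pderivs_lin a s sf smoothT0.
by under eq_fun do rewrite addr0; move=> ->; apply/funext => x; rewrite pderivs0 addr0.
Qed.

Lemma pderivs_shift f s y : pderivs s (fun x => f (x - y)) =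
  fun x => pderivs s f (x - y).
Proof.
elim: s => [|i s IH]; first by [].
by rewrite [LHS]/= -/(pderivs _ _) IH; exact: pderiv_shift.
Qed.

Lemma smoothT_shift f y : sm setT f -> sm setT (fun x => f (x - y)).
Proof.
move=> sf; apply: (@smooth_coind (fun h => exists2 f, sm setT f &
  h = fun x => f (x - y))); last by exists f.
move=> _ [{}f {}sf ->]; split=> [x|i].
  apply: (@cvg_comp _ _ _ (fun z => z - y) (fun z => normc (f z - f (x - y)))
    (nbhs x) (nbhs (x - y))).
    by apply: cvgB; [exact: cvg_id|exact: cvg_cst].
  exact: (smooth_cvg sf).
exists (fun x => pd i f (x - y)); first by exists (pd i f) => //; exact: smooth_pderiv.
by move=> x; apply: has_pderiv_shift; exact: (smooth_has_pderiv _ sf).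
Qed.

(** Differentiating [phi (y - x)] in [x] instead of [y] only changes signs. *)
Lemma pderivs_reflect f s y : sm setT f ->
  pderivs s (fun x => f (y - x)) =
  fun x => ((-1) ^+ size s * pderivs s f (y - x) : R[i]).
Proof.
move=> sf; elim: s => [|i s IH]; first by apply/funext => x; rewrite expr0 mul1r.
rewrite [LHS]/= -/(pderivs _ _) IH; apply/funext => x; apply: has_pderivE.
rewrite exprS mulN1r mulNr -mulrN; apply: has_pderivZ.
apply: has_pderiv_reflect; exact: (smooth_has_pderiv _ (smooth_pderivs s sf)).
Qed.

Lemma fsupp_pderivs f s : fsupp (pderivs s f) `<=` fsupp f.
Proof.
rewrite {2}/fsupp [X in _ `<=` X](closure_id _).1; last exact: closed_closure.
apply: closure_subset => x /= fx; apply: contrapT => nfx.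
move/eqP: fx; apply.
have oN : open (~` fsupp f) by apply: closed_openC; exact: closed_closure.
rewrite (@eq_on_pderivs _ _ (fun=> 0) s oN) ?pderivs0// => y Ny.
apply/eqP; apply: contrapT => /negP fy; apply: Ny; exact: subset_closure.
Qed.

Lemma notin_fsupp f x : ~ fsupp f x -> f x = 0.
Proof.
by move=> fx; apply/eqP; apply: contrapT => /negP nx; apply: fx; exact: subset_closure.
Qed.

End PartialDerivatives.

(** * Equality of mixed derivatives, and a Lipschitz bound *)

Section SchwarzTheorem.
Variables (R : realType) (n : nat).
Local Notation Rn := 'rV[R]_n.
Local Notation C := (@lcsC R).
Local Notation pd := (@pderiv R n C).
Local Notation sm := (@smooth_on R n C).
Local Notation e_ i := (delta_mx 0 i : Rn).
Implicit Types (i : 'I_n) (x y : Rn) (s : seq 'I_n).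

Lemma normr_coord x i : `|x 0 i| <= `|x|.
Proof.
rewrite [leRHS]/Num.norm /= mx_normrE.
exact: (le_bigmax _ (fun ij : 'I_1 * 'I_n => `|x ij.1 ij.2|) (0, i)).
Qed.

Lemma normr_delta i : `|e_ i| <= 1.
Proof.
rewrite [leLHS]/Num.norm /= mx_normrE; apply: bigmax_le => // -[a b] _ /=.
by rewrite mxE; case: (_ && _); rewrite ?normr1 ?normr0.
Qed.

Let der (f : Rn -> R) i (g : Rn -> R) :=
  forall x, is_derive (0 : R) 1 (fun h : R => f (x + h *: e_ i)) (g x).

Let der_line f i g : der f i g ->
  forall x (t : R), is_derive t 1 (fun h : R => f (x + h *: e_ i)) (g (x + t *: e_ i)).
Proof.
move=> fg x t; have := fg (x + t *: e_ i).
rewrite -[X in is_derive X _ _ _](addNr t) -[X in - t + X]mul1r.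
move=> /is_derive_affine; rewrite mul1r.
by under eq_fun do rewrite -addrA -scalerDl mul1r addrA subrr add0r.
Qed.

(** The mean value theorem in each of the two variables turns the second
    difference quotient into a value of the mixed derivative nearby. *)
Let second_difference (f fi fij : Rn -> R) i j x (h : R) :
  der f i fi -> der fi j fij -> exists s r : R, [/\ `|s| <= `|h|, `|r| <= `|h| &
    f (x + h *: e_ i + h *: e_ j) - f (x + h *: e_ i) - (f (x + h *: e_ j) - f x)
    = fij (x + s *: e_ i + r *: e_ j) * h * h].
Proof.
move=> dfi dfij.
pose u (s : R) := f (x + h *: e_ j + s *: e_ i) + - f (x + s *: e_ i).
pose v (s : R) := fi (x + h *: e_ j + s *: e_ i) + - fi (x + s *: e_ i).
have uv (t : R) : is_derive t 1 u (v t).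
  apply: is_derive1D; first exact: der_line.
  by apply: is_deriveN; exact: der_line.
have [s sh sE] := mvt0 uv h.
have [r rh rE] := mvt0 (der_line dfij (x + s *: e_ i)) h.
exists s, r; split=> //; rewrite -rE scale0r addr0.
have -> : fi (x + s *: e_ i + h *: e_ j) - fi (x + s *: e_ i) = v s.
  by rewrite /v addrAC.
by rewrite -sE /u !scale0r !addr0 [x + h *: e_ j + _]addrAC.
Qed.

(** Both mixed derivatives are limits of the same second difference quotient. *)
Let schwarz_real (f fi fj fij fji : Rn -> R) i j x :
  der f i fi -> der fi j fij -> der f j fj -> der fj i fji ->
  fij y @[y --> x] --> fij x -> fji y @[y --> x] --> fji x -> fij x = fji x.
Proof.
move=> dfi dfij dfj dfji cij cji; apply/eqP; rewrite eq_sym -subr_eq0 -normr_le0.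
apply/ler_addgt0Pr => eps eps0; rewrite add0r.
have e20 : 0 < eps / 2 by rewrite divr_gt0.
have /nbhs_ballP[d d0 Hd] : \forall y \near x,
    `|fij x - fij y| < eps / 2 /\ `|fji x - fji y| < eps / 2.
  move/cvgrPdist_lt : cij => /(_ _ e20) A; move/cvgrPdist_lt : cji => /(_ _ e20).
  by apply: filterS2 A.
pose h := d / 4; have h0 : 0 < h by rewrite divr_gt0.
have small (a b : R) k l : `|a| <= `|h| -> `|b| <= `|h| ->
    ball x d (x + a *: e_ k + b *: e_ l).
  move=> ah bh; rewrite -ball_normE /ball_/= -addrA opprD addrA subrr sub0r normrN.
  rewrite (le_lt_trans (ler_normD _ _))// !normrZ.
  have le1 (c : R) m : `|c| <= `|h| -> `|c| * `|e_ m| <= h.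
    by move=> ch; rewrite -[leRHS]mulr1 ler_pM ?normr_delta// (le_trans ch)// gtr0_norm.
  rewrite (le_lt_trans (lerD (le1 _ _ ah) (le1 _ _ bh)))//.
  by move: d0 => /= d0; rewrite /h; lra.
have [s [r [sh rh E1]]] := second_difference x h dfi dfij.
have [s' [r' [sh' rh' E2]]] := second_difference x h dfj dfji.
have E : fij (x + s *: e_ i + r *: e_ j) = fji (x + s' *: e_ j + r' *: e_ i).
  apply: (@mulIf _ h); first by rewrite gt_eqF.
  apply: (@mulIf _ h); first by rewrite gt_eqF.
  rewrite -E1 -E2 [x + h *: e_ j + _]addrAC; ring.
have [A _] := Hd _ (small _ _ i j sh rh).
have [_ B] := Hd _ (small _ _ j i sh' rh').
rewrite -E in B; set z := fij (x + _ + _) in A B.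
have -> : fji x - fij x = (fji x - z) - (fij x - z) by ring.
rewrite (le_trans (ler_normB _ _))// ltW//.
by rewrite (lt_le_trans (ltrD B A))//; lra.
Qed.

Lemma pderiv_comm (f : Rn -> C) i j : smooth_on setT f ->
  pd i (pd j f) = pd j (pd i f).
Proof.
move=> sf; apply/funext => x.
have si k := smooth_pderiv k sf; have sij k l := smooth_pderiv l (si k).
have D k g : sm setT g -> der (fun y => complex.Re (g y)) k
    (fun y => complex.Re (pd k g y)) /\
  der (fun y => complex.Im (g y)) k (fun y => complex.Im (pd k g y)).
  move=> sg; split=> y; have /curve_derivP[] := smooth_has_pderiv k sg (x := y) I.
    by [].
  by [].
have cvgRI g : sm setT g ->
    complex.Re (g y) @[y --> x] --> complex.Re (g x) /\
    complex.Im (g y) @[y --> x] --> complex.Im (g x).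
  move=> sg; have FF : Filter (nbhs x) by typeclasses eauto.
  have [r m] := (@cvg_normc R _ (nbhs x) FF (fun y => g y - g x)).1
    (smooth_cvg (x := x) sg I).
  split; apply/subr_cvg0.
    by apply: (cvg_ext _ r) => y; rewrite !ReImE.
  by apply: (cvg_ext _ m) => y; rewrite !ReImE.
apply: complex_eqP.
  exact: (schwarz_real (D j _ sf).1 (D i _ (si j)).1 (D i _ sf).1 (D j _ (si i)).1
    (cvgRI _ (sij j i)).1 (cvgRI _ (sij i j)).1).
exact: (schwarz_real (D j _ sf).2 (D i _ (si j)).2 (D i _ sf).2 (D j _ (si i)).2
    (cvgRI _ (sij j i)).2 (cvgRI _ (sij i j)).2).
Qed.

Lemma perm_pderivs (f : Rn -> C) s t : smooth_on setT f -> perm_eq s t ->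
  pderivs s f = pderivs t f.
Proof.
move=> sf; elim: s t => [|i s IH] t.
  by move=> /perm_size /esym/size0nil ->.
move=> st; have it : i \in t by rewrite -(perm_mem st) mem_head.
case/splitPr: it st => t1 t2 st.
have mv : pderivs (t1 ++ i :: t2) f = pd i (pderivs (t1 ++ t2) f).
  elim: t1 {st} => [|j t1 IHt]; first by [].
  rewrite [LHS]/= -/(pderivs _ _) IHt; exact/pderiv_comm/smooth_pderivs.
rewrite mv [LHS]/= -/(pderivs _ _) (IH (t1 ++ t2))//.
rewrite -(perm_cons i); apply: (perm_trans st).
exact: (permEl (perm_catCA t1 [:: i] t2)).
Qed.

(** The seminorms only involve derivatives in the order of [mderiv], while
    composing two of them produces another order. *)
Lemma pderivs_mderiv (f : Rn -> C) s : smooth_on setT f ->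
  exists2 a, mlength a = size s & pderivs s f = mderiv a f.
Proof.
move=> sf; have [a sa ps] := perm_index_seq s.
by exists a => //; rewrite mderivE; exact: perm_pderivs.
Qed.

(** Along a coordinate direction this is the mean value inequality; the
    difference of two points is a sum of such displacements. *)
Lemma lipschitz_of_pderiv (f : Rn -> C) (g : 'I_n -> Rn -> C) (M : R) :
  (forall i x, has_pderiv f i x (g i x)) -> (forall i x, normc (g i x) <= M) ->
  forall x y, normc (f y - f x) <= 2 * M * n%:R * `|y - x|.
Proof.
move=> fg fM x y; set v := y - x.
have step z i (t : R) : normc (f (z + t *: e_ i) - f z) <= 2 * M * `|t|.
  have H t' : is_curve_deriv (fun h : R => f (z + h *: e_ i) : C) t'
      (g i (z + t' *: e_ i)) by exact/has_pderiv_line.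
  by have := curve_mvt H (fun t => fM i _) t; rewrite scale0r addr0.
have sum s : normc (f (x + \sum_(i <- s) v 0 i *: e_ i) - f x) <=
    \sum_(i <- s) 2 * M * `|v 0 i|.
  elim: s => [|i s IH]; first by rewrite !big_nil addr0 subrr normc0.
  rewrite !big_cons addrCA addrC; set z := x + _ in IH *.
  rewrite -(subrK (f z) (f (z + _))) -addrA (le_trans (normcD _ _))//.
  by rewrite lerD.
have M0 (i : 'I_n) : 0 <= M by exact: le_trans (normc_ge0 _) (fM i x).
have -> : y = x + \sum_i v 0 i *: e_ i by rewrite -row_sum_delta addrC subrK.
rewrite (le_trans (sum _))//.
apply: (@le_trans _ _ (\sum_(i < n) 2 * M * `|v|)).
  apply: ler_sum => i _; rewrite ler_wpM2l ?normr_coord//.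
  by rewrite mulr_ge0// (M0 i).
by rewrite sumr_const card_ord -[leLHS]mulr_natr mulrAC.
Qed.

End SchwarzTheorem.

(** * Bounds for test functions *)

Section TestFunctions.
Variables (R : realType) (n : nat).
Local Notation Rn := 'rV[R]_n.
Local Notation C := (@lcsC R).
Local Notation pd := (@pderiv R n C).
Local Notation sm := (@smooth_on R n C).
Implicit Types (W K L : set Rn) (phi : Rn -> C).

Lemma le_sup_bound (A : set R) (M : R) : 0 <= M -> (forall r, A r -> r <= M) ->
  sup A <= M.
Proof.
move=> M0 AM; have [->|/set0P A0] := eqVneq A set0; first by rewrite sup0.
by apply: ge_sup => // r; exact: AM.
Qed.

Lemma ge0_sup (A : set R) : (forall r, A r -> 0 <= r) -> 0 <= sup A.
Proof.
move=> A0; have [[[r Ar] Aub]|nsA] := pselect (has_sup A); last by rewrite sup_out.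
by apply: le_trans (A0 _ Ar) _; exact: ub_le_sup.
Qed.

Lemma ub_le_sup_of (A : set R) (M r : R) : (forall r, A r -> r <= M) -> A r ->
  r <= sup A.
Proof. by move=> AM; apply: ub_le_sup; exists M => q; exact: AM. Qed.

Lemma fnorm_ge0 K m phi : 0 <= fnorm K m phi.
Proof. by apply: ge0_sup => _ [x [a [_ _ ->]]]; exact: normc_ge0. Qed.

Lemma fnorm_le K m phi (M : R) : 0 <= M ->
  (forall s x, (size s <= m)%N -> K x -> normc (pderivs s phi x) <= M) ->
  fnorm K m phi <= M.
Proof.
move=> M0 HM; apply: le_sup_bound => // _ [x [a [Kx am ->]]].
by rewrite mderivE; apply: HM => //; rewrite size_index_seq.
Qed.

Lemma mderiv_le_fnorm U K m phi a x : smooth_on U phi -> compact K -> K `<=` U ->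
  (mlength a <= m)%N -> K x -> normc (mderiv a phi x) <= fnorm K m phi.
Proof.
move=> sphi cK KU am Kx; have [M _ HM] := smooth_bounded m cK KU sphi.
apply: (@ub_le_sup_of _ M); last by exists x, a.
move=> _ [y [b [Ky bm ->]]]; rewrite mderivE; apply: HM => //.
by rewrite size_index_seq.
Qed.

Lemma is_test_pderivs W s phi : is_test W phi -> is_test W (pderivs s phi).
Proof.
move=> [sphi cphi pW]; have sub := @fsupp_pderivs R n phi s.
split; [exact: smooth_pderivs| |exact: subset_trans pW].
by apply: subclosed_compact cphi sub; exact: closed_closure.
Qed.

Lemma is_test_bounded W m phi : is_test W phi -> exists2 M, 0 <= M &
  forall s x, (size s <= m)%N -> normc (pderivs s phi x) <= M.
Proof.
move=> [sphi cphi _]; have [M M0 HM] := smooth_bounded m cphi (@subsetT _ _) sphi.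
exists M => // s x sm; have [px|npx] := pselect (fsupp phi x); first exact: HM.
rewrite notin_fsupp ?normc0// => /fsupp_pderivs px; exact: npx.
Qed.

Lemma pderivs_le_fnorm W m phi s x : is_test W phi -> (size s <= m)%N ->
  normc (pderivs s phi x) <= fnorm setT m phi.
Proof.
move=> tphi sm; have [M _ HM] := is_test_bounded m tphi.
have [sphi _ _] := tphi; have [a sa ->] := pderivs_mderiv s sphi.
apply: (@ub_le_sup_of _ M); last by exists x, a; rewrite sa.
move=> _ [y [b [Ky bm ->]]]; rewrite mderivE; apply: HM => //.
by rewrite size_index_seq.
Qed.

Lemma fsupp_lin (a : R[i]) (phi psi : Rn -> C) L : closed L ->
  fsupp phi `<=` L -> fsupp psi `<=` L ->
  fsupp (fun x => (a * phi x + psi x : R[i]) : C) `<=` L.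
Proof.
move=> cL pL qL; rewrite (closure_id L).1//; apply: closure_subset => x /= nz.
apply: contrapT => nLx; move/eqP: nz; apply.
rewrite (_ : phi x = 0); last by apply: notin_fsupp => /pL.
rewrite (_ : psi x = 0); last by apply: notin_fsupp => /qL.
by rewrite mulr0 addr0.
Qed.

Lemma is_test_lin (a : R[i]) (phi psi : Rn -> C) W L : compact L -> closed L ->
  L `<=` W -> is_test W phi -> fsupp phi `<=` L -> is_test W psi ->
  fsupp psi `<=` L -> is_test W (fun x => (a * phi x + psi x : R[i]) : C).
Proof.
move=> cL lL LW [sp _ _] pL [sq _ _] qL; have sub := fsupp_lin (a := a) lL pL qL.
split; [exact: smoothT_lin| |exact: subset_trans LW].
by apply: subclosed_compact cL sub; exact: closed_closure.
Qed.

End TestFunctions.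

(** * Kernels built from the translates of a test function *)

Section TranslatedKernels.
Variables (R : realType) (n : nat).
Local Notation Rn := 'rV[R]_n.
Local Notation C := (@lcsC R).
Local Notation pd := (@pderiv R n C).
Local Notation sm := (@smooth_on R n C).
Local Notation e_ i := (delta_mx 0 i : Rn).
Implicit Types (i : 'I_n) (x y : Rn) (s : seq 'I_n) (chi psi : Rn -> C).

Lemma compact_closed_rV (K : set Rn) : compact K -> closed K.
Proof. by apply: compact_closed; exact: norm_hausdorff. Qed.

Lemma continuous_translate x : continuous (fun y : Rn => y - x).
Proof.
move=> y; have FF : Filter (nbhs y) by typeclasses eauto.
exact: (@cvgB _ _ _ (nbhs y) FF id (cst x) y x cvg_id (cvg_cst x)).
Qed.

Definition cutoff_kernel chi psi : Rn -> Rn -> C :=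
  fun x y => (chi x * psi (y - x) : R[i]).

Lemma pderivs_cutoff chi psi s x : sm setT psi ->
  pderivs s (cutoff_kernel chi psi x) = cutoff_kernel chi (pderivs s psi) x.
Proof.
move=> sp; rewrite /cutoff_kernel pderivsZ; last exact: smoothT_shift.
by rewrite pderivs_shift.
Qed.

Lemma cutoff_has_pderiv chi psi i x y : sm setT chi -> sm setT psi ->
  has_pderiv (fun z => cutoff_kernel chi psi z y) i x
    (cutoff_kernel (pd i chi) psi x y - cutoff_kernel chi (pd i psi) x y).
Proof.
move=> sc sp; have A := smooth_has_pderiv i sc (x := x) I.
have B : has_pderiv (fun z => psi (y - z)) i x (- pd i psi (y - x)).
  by apply: has_pderiv_reflect; exact: (smooth_has_pderiv _ sp).
have := curve_derivM A B; rewrite scale0r addr0 mulrN; exact.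
Qed.

Lemma fsupp_cutoff chi psi x :
  fsupp (cutoff_kernel chi psi x) `<=` [set y | fsupp chi x /\ fsupp psi (y - x)].
Proof.
have [cx|ncx] := pselect (fsupp chi x); last first.
  move=> y; rewrite /fsupp /cutoff_kernel (notin_fsupp ncx).
  rewrite (_ : [set _ | _] = set0) ?closure0//.
  by apply/seteqP; split=> z //=; rewrite mul0r eqxx.
have cl : closed [set y | fsupp psi (y - x)].
  apply: (@closed_comp _ _ (fun y => y - x) (fsupp psi)) => [y _|].
    exact: continuous_translate.
  exact: closed_closure.
have sub : [set y | cutoff_kernel chi psi x y != 0] `<=`
    [set y | fsupp psi (y - x)].
  move=> y /= nz; apply: contrapT => np; move/eqP: nz; apply.
  by rewrite /cutoff_kernel (notin_fsupp np) mulr0.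
by move=> y /(closure_subset sub); rewrite -((closure_id _).1 cl).
Qed.

Section Spaces.
Variables (W L : set Rn).
Hypotheses (cL : compact L) (LW : L `<=` W).

Definition tested phi := is_test W phi /\ fsupp (phi : Rn -> C) `<=` L.

Lemma tested_lin (a : R[i]) phi psi : tested phi -> tested psi ->
  tested (fun x => (a * phi x + psi x : R[i]) : C).
Proof.
move=> [tp pL] [tq qL]; have lL := compact_closed_rV cL; split.
  exact: (is_test_lin a cL lL LW tp pL tq qL).
exact: fsupp_lin.
Qed.

Lemma testedZ (a : R[i]) phi : tested phi -> tested (fun x => (a * phi x : R[i]) : C).
Proof.
move=> tp; have := tested_lin (a - 1) tp tp; congr tested.
by apply/funext => x; rewrite mulrBl mul1r subrK.
Qed.

(** The functions of the form [cutoff_kernel chi psi], closed up under linear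
    combinations so as to be stable under differentiation in [x]. *)
Inductive kernel_span : (Rn -> Rn -> C) -> Prop :=
| kernel_cutoff chi psi : is_test setT chi -> is_test setT psi ->
    (forall x y, fsupp chi x -> fsupp psi y -> L (x + y)) ->
    kernel_span (cutoff_kernel chi psi)
| kernel_lin (a : R[i]) G H : kernel_span G -> kernel_span H ->
    kernel_span (fun x y => (a * G x y + H x y : R[i])).

Lemma kernel_span_tested G x : kernel_span G -> tested (G x).
Proof.
elim=> {G} [chi psi [sc _ _] [sp cp _] sub|a G H _ tG _ tH]; last exact: tested_lin.
have sL : fsupp (cutoff_kernel chi psi x) `<=` L.
  move=> y /fsupp_cutoff[cx py]; rewrite -(subrK x y) addrC; exact: sub.
split=> //; split; last exact: subset_trans LW.
  by apply: smoothTZ; exact: smoothT_shift.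
by apply: subclosed_compact cL sL; exact: closed_closure.
Qed.

Lemma kernel_span_smooth G x : kernel_span G -> sm setT (G x).
Proof. by move=> /(kernel_span_tested x)[[]]. Qed.

Lemma pderivs_kernel_lin (a : R[i]) G H s x : kernel_span G -> kernel_span H ->
  pderivs s (fun y => (a * G x y + H x y : R[i]) : C) =
  fun y => (a * pderivs s (G x) y + pderivs s (H x) y : R[i]).
Proof. by move=> kG kH; apply: pderivs_lin; exact: kernel_span_smooth. Qed.

(** The mean value inequality in [x], for all derivatives in [y] at once. *)
Lemma kernel_span_lipschitz G m : kernel_span G -> exists2 M, 0 <= M &
  forall s x z y, (size s <= m)%N ->
    normc (pderivs s (G z) y - pderivs s (G x) y) <= M * `|z - x|.
Proof.
elim=> {G} [chi psi tc tp _|a G H kG [M M0 HM] kH [N N0 HN]].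
  have [sc _ _] := tc; have [sp _ _] := tp.
  have [A A0 HA] := is_test_bounded 1 tc; have [B B0 HB] := is_test_bounded m.+1 tp.
  exists (2 * (A * B + A * B) * n%:R); first by rewrite !mulr_ge0 ?addr_ge0 ?mulr_ge0.
  move=> s x z y sm'; rewrite !pderivs_cutoff//.
  have sps := smooth_pderivs s sp.
  have D i w := @cutoff_has_pderiv chi (pderivs s psi) i w y sc sps.
  apply: (lipschitz_of_pderiv D) => i w; apply: (le_trans (normcB _ _)).
  rewrite !normcM lerD// ler_pM ?normc_ge0//.
  - exact: (HA [:: i]).
  - by apply: HB; exact: leqW.
  - exact: (HA [::]).
  - exact: (HB (i :: s)).
exists (normc a * M + N); first by rewrite addr_ge0 ?mulr_ge0 ?normc_ge0.
move=> s x z y sm'; rewrite !pderivs_kernel_lin// opprD addrACA -mulrBr.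
rewrite (le_trans (normcD _ _))// mulrDl lerD ?HN// normcM -mulrA.
by rewrite ler_wpM2l ?normc_ge0// HM.
Qed.

(** Taylor's formula in [x], uniformly in [y]: the derivatives in [y] merely
    replace [psi] by one of its derivatives. *)
Lemma kernel_span_taylor G i : kernel_span G -> exists2 G', kernel_span G' &
  forall m, exists2 M, 0 <= M & forall s x y (h : R), (size s <= m)%N ->
    normc (pderivs s (G (x + h *: e_ i)) y - pderivs s (G x) y
           - (h%:C)%C * pderivs s (G' x) y) <= M * `|h| ^+ 2.
Proof.
elim=> {G} [chi psi tc tp sub|a G H kG [G' kG' HG] kH [H' kH' HH]].
  have [sc _ _] := tc; have [sp _ _] := tp.
  have kc : kernel_span (cutoff_kernel (pd i chi) psi).
    apply: kernel_cutoff => //; first exact: (is_test_pderivs [:: i]).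
    by move=> x y /(fsupp_pderivs (s := [:: i])); exact: sub.
  have kp : kernel_span (cutoff_kernel chi (pd i psi)).
    apply: kernel_cutoff => //; first exact: (is_test_pderivs [:: i]).
    by move=> x y cx /(fsupp_pderivs (s := [:: i])); exact: sub.
  exists (fun x y => (-1 * cutoff_kernel chi (pd i psi) x y +
                      cutoff_kernel (pd i chi) psi x y : R[i])).
    exact: kernel_lin.
  move=> m; have [A A0 HA] := is_test_bounded 2 tc.
  have [B B0 HB] := is_test_bounded m.+2 tp.
  exists (2 * (A * B + A * B + (A * B + A * B))).
    by rewrite mulr_ge0 ?addr_ge0 ?mulr_ge0.
  move=> s x y h sm'; rewrite pderivs_kernel_lin// !pderivs_cutoff//; last first.
    exact: smooth_pderiv.
  have -> : pderivs s (pd i psi) = pd i (pderivs s psi).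
    rewrite -pderivs_rcons; apply: (perm_pderivs (t := i :: s)) => //.
    by rewrite perm_rcons.
  set q := pderivs s psi; have sq : sm setT q by exact: smooth_pderivs.
  have sq' := smooth_pderiv i sq; have sc' := smooth_pderiv i sc.
  pose k := @cutoff_kernel; pose z (t : R) := x + t *: e_ i.
  have D0 t := (@has_pderiv_line _ _ _ _ _ _ _).1
    (@cutoff_has_pderiv chi q i (z t) y sc sq).
  have D1 t : is_curve_deriv (fun t => (k (pd i chi) q (z t) y
      - k chi (pd i q) (z t) y : C)) t
      (k (pd i (pd i chi)) q (z t) y - k (pd i chi) (pd i q) (z t) y -
        (k (pd i chi) (pd i q) (z t) y - k chi (pd i (pd i q)) (z t) y)).
    have D := (@has_pderiv_line _ _ _ _ _ _ _).1
      (@cutoff_has_pderiv (pd i chi) q i (z t) y sc' sq).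
    have D' := (@has_pderiv_line _ _ _ _ _ _ _).1
      (@cutoff_has_pderiv chi (pd i q) i (z t) y sc sq').
    have := curve_derivD D (curve_derivM (curve_deriv_cst (-1) t) D').
    by rewrite mul0r add0r mulN1r; under eq_fun do rewrite mulN1r.
  have bnd t : normc (k (pd i (pd i chi)) q (z t) y - k (pd i chi) (pd i q) (z t) y -
      (k (pd i chi) (pd i q) (z t) y - k chi (pd i (pd i q)) (z t) y)) <=
      A * B + A * B + (A * B + A * B).
    have bd c p : normc (c (z t)) <= A -> normc (p (y - z t)) <= B ->
        normc (k c p (z t) y) <= A * B.
      by move=> ? ?; rewrite normcM ler_pM ?normc_ge0.
    have q0 : normc (q (y - z t)) <= B by apply: HB; exact/leqW/leqW.
    have q1 : normc (pd i q (y - z t)) <= B by apply: (HB (i :: s)); exact/leqW.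
    have q2 : normc (pd i (pd i q) (y - z t)) <= B by exact: (HB [:: i, i & s]).
    have c0 : normc (chi (z t)) <= A by exact: (HA [::]).
    have c1 : normc (pd i chi (z t)) <= A by exact: (HA [:: i]).
    have c2 : normc (pd i (pd i chi) (z t)) <= A by exact: (HA [:: i; i]).
    rewrite (le_trans (normcB _ _))// lerD// (le_trans (normcB _ _))// lerD//;
      exact: bd.
  have := curve_taylor D0 D1 bnd h.
  by rewrite /z scale0r addr0 mulN1r [X in _ * X]addrC.
exists (fun x y => (a * G' x y + H' x y : R[i])); first exact: kernel_lin.
move=> m; have [M M0 HM] := HG m; have [N N0 HN] := HH m.
exists (normc a * M + N); first by rewrite addr_ge0 ?mulr_ge0 ?normc_ge0.
move=> s x y h sm'; rewrite !pderivs_kernel_lin//.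
set g1 := pderivs _ _ _; set h1 := pderivs _ _ _; set g0 := pderivs _ _ _.
set h0 := pderivs _ _ _; set g' := pderivs _ _ _; set h' := pderivs _ _ _.
have -> : a * g1 + h1 - (a * g0 + h0) - (h%:C)%C * (a * g' + h') =
  a * (g1 - g0 - (h%:C)%C * g') + (h1 - h0 - (h%:C)%C * h') by ring.
rewrite (le_trans (normcD _ _))// mulrDl lerD ?HN// normcM -mulrA.
by rewrite ler_wpM2l ?normc_ge0// HM.
Qed.

(** Smoothness into a space of test functions uses only three of its properties:
    it contains the functions supported in [L], on these its seminorms
    are dominated by the uniform norms of derivatives, and its limits are limits
    at each point. *)
Section Smoothness.
Variables (car : set (Rn -> C)) (sem : set ((Rn -> C) -> R)).
Let E : lcs R := @LCS R (Rn -> C) car sem.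
Hypothesis carT : forall phi, tested phi -> car phi.
Hypothesis semT : forall p, sem p -> exists2 K, 0 <= K & exists m,
  forall phi, tested phi -> `|p phi| <= K * fnorm L m phi.
Hypothesis pointwise : forall (c : R -> E) (t : R) (l : E), (forall s : R, tested (c s)) ->
  is_curve_deriv c t l ->
  forall y, is_curve_deriv (fun s : R => c s y : C) t (l y).

Lemma kernel_span_pderiv G i : kernel_span G -> exists2 G', kernel_span G' &
  forall x, is_curve_deriv (fun h : R => G (x + h *: e_ i) : E) 0 (G' x : E).
Proof.
move=> kG; have [G' kG' HT] := kernel_span_taylor i kG.
exists G' => // x; split; first exact/carT/kernel_span_tested.
move=> p /semT[K K0 [m Km]]; have [M M0 HM] := HT m.
apply/cvgr0Pnorm_lt => eps eps0.
have FF : Filter (0 : R)^' by typeclasses eauto.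
have KM0 : 0 <= K * M by exact: mulr_ge0.
near=> h; have h0 : h != 0 by near: h; exact: nbhs_dnbhs_neq.
rewrite add0r scale0r addr0; set q := (X in p X).
set a : R[i] := ((h^-1)%:C)%C.
have qE : q = fun y => -1 * (a * G x y + G' x y) + a * G (x + h *: e_ i) y :> R[i].
  have ringE (u v w : R[i]) : a * (u - v) - w = -1 * (a * v + w) + a * u by ring.
  by apply/funext => y; exact: ringE.
have tG z := kernel_span_tested z kG; have tG' z := kernel_span_tested z kG'.
have tq : tested q by rewrite qE; do 2?apply: tested_lin => //; exact: testedZ.
apply: (le_lt_trans (Km _ tq)); apply: (@le_lt_trans _ _ (K * (M * `|h|))).
  apply: ler_wpM2l => //; apply: fnorm_le => [|s y sm' _]; first exact: mulr_ge0.
  rewrite qE pderivs_lin; last 2 first.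
  - by have [[]] := tested_lin a (tG x) (tG' x).
  - by have [[]] := testedZ a (tG (x + h *: e_ i)).
  rewrite pderivs_lin ?pderivsZ; try exact: kernel_span_smooth.
  set g0 := pderivs _ (G x) _; set g' := pderivs _ _ _; set g1 := pderivs _ _ _.
  have -> : -1 * (a * g0 + g') + a * g1 = a * (g1 - g0 - (h%:C)%C * g').
    rewrite mulrBr mulrA -rmorphM/= mulVf// rmorph1 mul1r; ring.
  rewrite normcM normc_real normrV ?unitfE// ler_pdivrMl ?normr_gt0//.
  by rewrite mulrCA -expr2 HM.
rewrite mulrA; apply: (@le_lt_trans _ _ ((K * M + 1) * `|h|)).
  by rewrite ler_wpM2r// lerDl.
rewrite mulrC -ltr_pdivlMr ?ltr_wpDl//.
by near: h; apply: dnbhs0_lt; rewrite divr_gt0 ?ltr_wpDl.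
Unshelve. all: by end_near. Qed.

Lemma kernel_span_cvg G x p : kernel_span G -> sem p ->
  p (G y - G x) @[y --> x] --> (0 : R).
Proof.
move=> kG /semT[K K0 [m Km]]; have [M M0 HM] := kernel_span_lipschitz m kG.
have FF : Filter (nbhs x) by typeclasses eauto.
apply/(@cvgr0Pnorm_lt _ _ _ (nbhs x) FF) => eps eps0.
have KM0 : 0 <= K * M by exact: mulr_ge0.
have tG z := kernel_span_tested z kG.
near=> z; set q := (X in p X).
have qE : q = fun y => -1 * G x y + G z y :> R[i].
  by apply/funext => y; rewrite mulN1r addrC.
have tq : tested q by rewrite qE; exact: tested_lin.
apply: (le_lt_trans (Km _ tq)); apply: (@le_lt_trans _ _ (K * (M * `|z - x|))).
  apply: ler_wpM2l => //; apply: fnorm_le => [|s y sm' _]; first exact: mulr_ge0.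
  rewrite qE pderivs_lin; try exact: kernel_span_smooth.
  by rewrite mulN1r addrC HM.
rewrite mulrA; apply: (@le_lt_trans _ _ ((K * M + 1) * `|z - x|)).
  by rewrite ler_wpM2r// lerDl.
rewrite mulrC -ltr_pdivlMr ?ltr_wpDl// distrC.
near: z; apply: (@cvgr_dist_lt _ _ _ (nbhs x) FF id x cvg_id).
by rewrite divr_gt0 ?ltr_wpDl.
Unshelve. all: by end_near. Qed.

(** Derivatives of kernels are again kernels, hence so are all iterated ones;
    uniqueness of the derivative follows from its pointwise uniqueness. *)
Lemma kernel_span_smooth_on G U : kernel_span G ->
  @smooth_on R n E U G.
Proof.
move=> kG; split=> [x _|s /= x _]; first exact/carT/kernel_span_tested.
have {}kG : kernel_span (foldr (@pderiv R n E) G s).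
  elim: s => [|i s IH]; first exact: kG.
  have [G' kG' DG'] := kernel_span_pderiv i IH.
  rewrite [foldr _ _ _]/=; set H := foldr _ _ _ in IH DG' *.
  suff -> : pderiv i (H : Rn -> E) = (G' : Rn -> E) by [].
  apply/funext => z; apply/funext => y.
  have tH (h : R) := kernel_span_tested (z + h *: e_ i) IH.
  have DH : is_curve_deriv (fun h : R => H (z + h *: e_ i) : E) 0
      (@pderiv R n E i H z).
    by rewrite /pderiv /curve_deriv; apply: xgetPex; exists (G' z); exact: DG'.
  exact: (curve_deriv_unique (pointwise tH DH y) (pointwise tH (DG' z) y)).
split=> [i|p]; last exact: kernel_span_cvg.
by have [G' _ DG'] := kernel_span_pderiv i kG; exists (G' x).
Qed.

End Smoothness.
End Spaces.
End TranslatedKernels.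

(** * The kernels as smooth maps into D(W) and into D_L(W) *)

Section KernelsAreSmooth.
Variables (R : realType) (n : nat) (W L : set 'rV[R]_n).
Local Notation Rn := 'rV[R]_n.
Local Notation C := (@lcsC R).
Hypotheses (oW : open W) (cL : compact L) (LW : L `<=` W).

Lemma normc_le_fnorm (K : set Rn) (phi : Rn -> C) y : smooth_on setT phi ->
  compact K -> K y -> normc (phi y) <= fnorm K 0 phi.
Proof.
move=> sp cK Ky; have [a sa E] := pderivs_mderiv [::] sp.
rewrite -[phi]/(pderivs [::] phi) E -E.
have := mderiv_le_fnorm (m := 0) (a := a) (x := y) sp cK (@subsetT _ _).
by rewrite sa -E => /(_ isT Ky).
Qed.

Lemma evaluation_seminorm y :
  lcs_seminorms (l := testfun W) (fun phi : Rn -> C => normc (phi y)).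
Proof.
split=> [phi psi _ _|z phi _|K [cK KW]].
- exact: normcD.
- exact: normcM.
exists 1, 0%N => phi [sp _ _] pK; rewrite mul1r.
have [Ky|nKy] := pselect (K y); first exact: normc_le_fnorm.
by rewrite (notin_fsupp (fun py => nKy (pK _ py))) normc0 fnorm_ge0.
Qed.

(** The continuity condition bounds [p] from above only; a seminorm is
    nonnegative because [0 = p (phi - phi) <= 2 p(phi)]. *)
Lemma testfun_seminorm_le p : lcs_seminorms (l := testfun W) p ->
  exists2 K, 0 <= K & exists m, forall phi, tested W L phi ->
    `|p phi| <= K * fnorm L m phi.
Proof.
move=> [pD pZ pB]; have wL : well_inside L W.
  by split=> // y Ly; apply: open_nbhs_nbhs; split=> //; exact: LW.
have [K [m HK]] := pB _ wL; exists `|K| => //; exists m => phi tp.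
have [tphi pL] := tp.
have p0 : 0 <= p phi.
  have tN : is_test W (-1 *: phi) by have [] := testedZ cL LW (-1) tp.
  have := pD _ _ tphi tN; rewrite pZ// scaleN1r subrr.
  rewrite -[X in p X](scale0r phi) pZ// normc0 mul0r.
  by rewrite normcN normc_real normr1 mul1r; lra.
rewrite ger0_norm//; apply: (le_trans (HK _ tphi pL)).
by rewrite ler_wpM2r ?fnorm_ge0// ler_norm.
Qed.

Lemma testfun_supp_seminorm_le p : lcs_seminorms (l := testfun_supp L W) p ->
  exists2 K, 0 <= K & exists m, forall phi, tested W L phi ->
    `|p phi| <= K * fnorm L m phi.
Proof.
move=> [m ->]; exists 1 => //; exists m => phi _.
by rewrite mul1r ger0_norm// fnorm_ge0.
Qed.

Lemma testfun_pointwise (c : R -> testfun W) t (l : testfun W) :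
  is_curve_deriv c t l ->
  forall y, is_curve_deriv (fun s : R => c s y : C) t (l y).
Proof.
move=> [_ cl] y; split=> // _ ->; exact: (cl _ (evaluation_seminorm y)).
Qed.

(** Point evaluations are not among the seminorms of [testfun_supp L W], but on
    [L] they are dominated by [fnorm L 0], and off [L] all its elements vanish. *)
Lemma testfun_supp_pointwise (c : R -> testfun_supp L W) t
    (l : testfun_supp L W) : (forall s : R, tested W L (c s)) ->
  is_curve_deriv c t l ->
  forall y, is_curve_deriv (fun s : R => c s y : C) t (l y).
Proof.
move=> tc [tl cl] y; split=> // _ ->.
pose q (h : R) : Rn -> C := ((h^-1)%:C)%C *: (c (t + h) - c t) - l.
have tq h : tested W L (q h).
  have := tested_lin cL LW (-1) tl (tested_lin cL LW (- ((h^-1)%:C)%C) (tc t)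
    (testedZ cL LW ((h^-1)%:C)%C (tc (t + h)))).
  congr tested; apply/funext => z.
  have ringE (a u v w : R[i]) : -1 * w + (- a * v + a * u) = a * (u - v) - w by ring.
  exact: ringE.
have q0 : fnorm L 0 (q h) @[h --> 0^'] --> (0 : R) by apply: cl; exists 0%N.
apply: (squeeze_cvgr _ (cvg_cst (0 : R)) q0); apply: nearW => h.
rewrite normc_ge0 /=; have [[sq _ _] qL] := tq h.
have [Ly|nLy] := pselect (L y); first exact: (normc_le_fnorm sq cL Ly).
have -> : normc (((h^-1)%:C)%C *: (c (t + h) y - c t y) - l y) = normc (q h y) by [].
by rewrite (notin_fsupp (fun qy => nLy (qL _ qy))) normc0 fnorm_ge0.
Qed.

Lemma kernel_smooth_testfun G U : kernel_span L G ->
  @smooth_on R n (testfun W) U G.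
Proof.
apply: (kernel_span_smooth_on cL LW) => [phi [tp _]||c t l _]; first exact: tp.
  exact: testfun_seminorm_le.
exact: testfun_pointwise.
Qed.

Lemma kernel_smooth_testfun_supp G U : kernel_span L G ->
  @smooth_on R n (testfun_supp L W) U G.
Proof.
apply: (kernel_span_smooth_on cL LW) => [phi tp||]; first exact: tp.
  exact: testfun_supp_seminorm_le.
exact: testfun_supp_pointwise.
Qed.

End KernelsAreSmooth.

(** * A flat function *)

Section FlatFunction.
Variable R : realType.
Implicit Types (u v : R -> R) (t : R).

(** The functions [t^-k exp(-1/t)], extended by zero to [t <= 0]; each of them
    has for derivative a linear combination of two others. *)
Definition flat k t : R := if 0 < t then t^-1 ^+ k * expR (- t^-1) else 0.

Lemma flat_gt0 k t : 0 < t -> 0 < flat k t.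
Proof. by move=> t0; rewrite /flat t0 mulr_gt0 ?expR_gt0 ?exprn_gt0 ?invr_gt0. Qed.

Lemma flat_le0 k t : t <= 0 -> flat k t = 0.
Proof. by move=> t0; rewrite /flat ltNge t0. Qed.

Lemma flat_ge0 k t : 0 <= flat k t.
Proof. by have [/(flat_le0 k)->|/(flat_gt0 k)/ltW] := leP t 0. Qed.

(** From [x^(k+1) / (k+1)! <= exp x] at [x = 1 / t]. *)
Lemma flat_bound k t : flat k t <= k.+1`!%:R * `|t|.
Proof.
have [t0|t0] := leP t 0; first by rewrite flat_le0// mulr_ge0.
rewrite /flat t0 expRN ler_pdivrMr ?expR_gt0// gtr0_norm//.
have x0 : 0 < t^-1 by rewrite invr_gt0.
have f0 : 0 < k.+1`!%:R :> R by rewrite ltr0n fact_gt0.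
have H : t^-1 ^+ k.+1 / k.+1`!%:R <= expR t^-1.
  by rewrite (le_trans _ (expR_ge1Dxn k (ltW x0)))// lerDr.
have -> : t^-1 ^+ k = t * t^-1 ^+ k.+1 by rewrite exprS mulrA divff ?mul1r ?gt_eqF.
by rewrite [leRHS]mulrAC [leRHS]mulrC ler_wpM2l ?(ltW t0)// mulrC -ler_pdivrMr.
Qed.

(** At [0] the difference quotient of [flat k] is [flat k.+1], which tends to 0. *)
Lemma is_derive_flat k t : is_derive t 1 (flat k)
  (flat k.+2 t + - k%:R * flat k.+1 t).
Proof.
have [t0|t0|->] := ltgtP t 0.
- rewrite !flat_le0 ?(ltW t0)// mulr0 addr0.
  apply: near_eq_is_derive (is_derive_cst (0 : R) t (1 : R)).
  have nt : \forall s \near t, s < 0 by exact: lt_nbhsl.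
  by apply: filterS nt => s s0; rewrite flat_le0 ?(ltW s0).
- apply: (@near_eq_is_derive R R R (fun s => s^-1 ^+ k * expR (- s^-1))).
    have nt : \forall s \near t, 0 < s by exact: lt_nbhsr.
    by apply: filterS nt => s s0; rewrite /flat s0.
  have tn0 : t != 0 by rewrite gt_eqF.
  have dV : is_derive t 1 (fun s : R => s^-1) (- t^-1 ^+ 2).
    have H : is_derive t 1 (fun s : R => s^-1) _ :=
      @is_deriveV R id t 1 1 tn0 (is_derive_id t 1).
    by apply: (is_derive_eq H); rewrite /GRing.scale /= mulr1 exprVn.
  have dX : is_derive t 1 (fun s : R => s^-1 ^+ k) (- k%:R * t^-1 ^+ k.+1).
    elim: k => [|k IH].
      by rewrite oppr0 mul0r; under eq_fun do rewrite expr0; exact: is_derive_cst.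
    under eq_fun do rewrite exprS.
    by apply: (is_derive_eq (is_derive1M dV IH)); rewrite !exprS -natr1; ring.
  have dE : is_derive t 1 (fun s : R => expR (- s^-1))
      (expR (- t^-1) * t^-1 ^+ 2).
    have N : is_derive t 1 (fun s : R => - s^-1) (t^-1 ^+ 2).
      by have := is_deriveN dV; rewrite opprK.
    exact: (@is_derive1_comp R expR (fun s => - s^-1) t _ _ (is_derive_expR _) N).
  apply: (is_derive_eq (is_derive1M dX dE)).
  by rewrite /flat t0 !exprS; ring.
- rewrite !flat_le0// mulr0 addr0; apply/is_derive1P.
  have b (h : R) : h != 0 -> `|h^-1 * (flat k (0 + h) - flat k 0) - 0|
      <= k.+2`!%:R * `|h|.
    move=> h0; rewrite add0r (@flat_le0 k 0)// !subr0.
    apply: le_trans (flat_bound k.+1 h); rewrite /flat; case: ifPn => hp.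
      by rewrite ger0_norm ?exprS ?mulrA// !mulr_ge0 ?exprn_ge0 ?expR_ge0 ?invr_ge0// ltW.
    by rewrite mulr0 normr0.
  apply/cvgr0Pnorm_lt => e e0; near=> h.
  have h0 : h != 0 by near: h; exact: nbhs_dnbhs_neq.
  apply: (le_lt_trans (b h h0)); rewrite mulrC -ltr_pdivlMr ?ltr0n ?fact_gt0//.
  by near: h; apply: dnbhs0_lt; rewrite divr_gt0// ltr0n fact_gt0.
Unshelve. all: by end_near. Qed.

Fixpoint smooth1 N u : Prop := continuous u /\
  if N is N'.+1 then exists2 v, (forall t, is_derive t 1 u (v t)) & smooth1 N' v
  else True.

Lemma derive_continuous u v : (forall t, is_derive t 1 u (v t)) -> continuous u.
Proof.
move=> uv t; apply/differentiable_continuous/derivable1_diffP.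
exact: (@ex_derive _ _ _ _ _ _ _ (uv t)).
Qed.

Lemma smooth1_lin N (a : R) u v : smooth1 N u -> smooth1 N v ->
  smooth1 N (fun t => u t + a * v t).
Proof.
elim: N u v => [|N IH] u v.
  move=> [cu _] [cv _]; split=> // t.
  exact: (continuousD (cu t) (continuousM (@cst_continuous _ _ a t) (cv t))).
move=> [cu [u' du su]] [cv [v' dv sv]]; split.
  move=> t.
  exact: (continuousD (cu t) (continuousM (@cst_continuous _ _ a t) (cv t))).
exists (fun t => u' t + a * v' t); last exact: IH.
move=> t; have := is_derive1M (is_derive_cst a t (1 : R)) (dv t).
by rewrite mul0r add0r => dav; exact: is_derive1D (du t) dav.
Qed.

Lemma smooth1_flat N k : smooth1 N (flat k).
Proof.
have c k' : continuous (flat k') by exact: derive_continuous (is_derive_flat k').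
elim: N k => [|N IH] k; first by split=> //; exact: c.
split; first exact: c.
exists (fun t => flat k.+2 t + - k%:R * flat k.+1 t); last exact: smooth1_lin.
exact: is_derive_flat.
Qed.

End FlatFunction.

(** * Products and compositions of smooth real functions *)

Section RealSmoothFunctions.
Variables (R : realType) (n : nat).
Local Notation Rn := 'rV[R]_n.
Local Notation e_ i := (delta_mx 0 i : Rn).
Implicit Types (f g : Rn -> R) (i : 'I_n) (x : Rn).

Definition real_pderiv f i x (l : R) :=
  is_derive (0 : R) 1 (fun h : R => f (x + h *: e_ i)) l.

(** Finite order of differentiability, by recursion: closure under products and
    compositions then follows by induction on the order. *)
Fixpoint smoothR N f : Prop := continuous f /\
  if N is N'.+1 then
    forall i, exists2 g, (forall x, real_pderiv f i x (g x)) & smoothR N' g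
  else True.

Lemma smoothR_continuous N f : smoothR N f -> continuous f.
Proof. by case: N => [|N] []. Qed.

Lemma smoothRW N f : smoothR N.+1 f -> smoothR N f.
Proof.
elim: N f => [|N IH] f [cf sf]; split=> // i.
by have [g fg sg] := sf i; exists g => //; exact: IH.
Qed.

Lemma smoothR_cst N (a : R) : smoothR N (fun=> a).
Proof.
have c b : continuous (fun _ : Rn => b : R) by exact: cst_continuous.
elim: N a => [|N IH] a; first by split=> //; exact: c.
split=> [|i]; first exact: c.
by exists (fun=> 0) => // x; exact: is_derive_cst.
Qed.

Lemma smoothRD N f g : smoothR N f -> smoothR N g -> smoothR N (fun x => f x + g x).
Proof.
elim: N f g => [|N IH] f g [cf sf] [cg sg].
  by split=> // x; exact: (continuousD (cf x) (cg x)).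
split=> [x|i]; first exact: (continuousD (cf x) (cg x)).
have [f' ff' sf'] := sf i; have [g' gg' sg'] := sg i.
exists (fun x => f' x + g' x); last exact: IH.
by move=> x; exact: is_derive1D (ff' x) (gg' x).
Qed.

Lemma smoothRM N f g : smoothR N f -> smoothR N g -> smoothR N (fun x => f x * g x).
Proof.
elim: N f g => [|N IH] f g sf sg.
  by split=> // x; exact: (continuousM (sf.1 x) (sg.1 x)).
split=> [x|i]; first exact: (continuousM (sf.1 x) (sg.1 x)).
have [f' ff' sf'] := sf.2 i; have [g' gg' sg'] := sg.2 i.
exists (fun x => f' x * g x + f x * g' x).
  move=> x; apply: (is_derive_eq (is_derive1M (ff' x) (gg' x))).
  by rewrite scale0r addr0.
by apply: smoothRD; apply: IH => //; exact: smoothRW.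
Qed.

Lemma smoothR_comp N (u : R -> R) f : smooth1 N u -> smoothR N f ->
  smoothR N (u \o f).
Proof.
elim: N u f => [|N IH] u f su sf.
  by split=> // x; exact: (continuous_comp (sf.1 x) (su.1 (f x))).
split=> [x|i]; first exact: (continuous_comp (sf.1 x) (su.1 (f x))).
have [v uv sv] := su.2; have [f' ff' sf'] := sf.2 i.
exists (fun x => (v \o f) x * f' x).
  move=> x; apply: (@is_derive1_comp R u (fun h => f (x + h *: e_ i))) (ff' x).
  by rewrite scale0r addr0; exact: uv.
by apply: smoothRM => //; apply: IH => //; exact: smoothRW.
Qed.

Lemma smoothR_coord N j : smoothR N (fun x : Rn => x 0 j).
Proof.
have cc : continuous (fun x : Rn => x 0 j) by exact: coord_continuous.
case: N => [|N]; split=> // i; exists (fun=> (i == j)%:R); last exact: smoothR_cst.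
move=> x; rewrite /real_pderiv.
have -> : (fun h : R => (x + h *: e_ i) 0 j) = fun h => x 0 j + (i == j)%:R * h.
  by apply/funext => h; rewrite !mxE eqxx /= mulrC eq_sym.
have H := @is_derive_affine R id (x 0 j) (i == j)%:R 0 1 (is_derive_id _ _).
by apply: (is_derive_eq H); rewrite mulr1.
Qed.

Lemma smoothR_sum N (I : Type) (s : seq I) (F : I -> Rn -> R) :
  (forall a, smoothR N (F a)) -> smoothR N (fun x => \sum_(a <- s) F a x).
Proof.
move=> sF; elim: s => [|a s IH].
  by under eq_fun do rewrite big_nil; exact: smoothR_cst.
by under eq_fun do rewrite big_cons; exact: smoothRD.
Qed.

Lemma smoothR_prod N (I : Type) (s : seq I) (F : I -> Rn -> R) :
  (forall a, smoothR N (F a)) -> smoothR N (fun x => \prod_(a <- s) F a x).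
Proof.
move=> sF; elim: s => [|a s IH].
  by under eq_fun do rewrite big_nil; exact: smoothR_cst.
by under eq_fun do rewrite big_cons; exact: smoothRM.
Qed.

Lemma smoothR_smooth_on f : (forall N, smoothR N f) ->
  @smooth_on R n lcsC setT (fun x => ((f x)%:C)%C).
Proof.
pose P (g : Rn -> @lcsC R) := exists2 f, (forall N, smoothR N f) &
  g = fun x => ((f x)%:C)%C.
move=> sf; apply: (@smooth_coind R n P); last by exists f.
move=> _ [{}f {}sf ->]; split=> [x|i].
  have FF : Filter (nbhs x) by typeclasses eauto.
  apply: ((@cvg_normc R _ (nbhs x) FF _).2); split.
    have K := (@subr_cvg0 _ _ _ (nbhs x) FF f (f x)).2 (smoothR_continuous (sf 0) (x := x)).
    by apply: (cvg_ext _ K) => y; rewrite !ReImE.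
  have K := @cvg_cst _ (0 : R) _ (nbhs x) FF.
  by apply: (cvg_ext _ K) => y; rewrite !ReImE /= subrr.
have [g fg _] := (sf 1).2 i.
exists (fun x => ((g x)%:C)%C).
  exists g => // N; have [g' fg' sg'] := (sf N.+1).2 i.
  rewrite (_ : g = g')//; apply/funext => x.
  by rewrite -[LHS](@derive_val _ _ _ _ _ _ _ (fg x))
    -[RHS](@derive_val _ _ _ _ _ _ _ (fg' x)).
move=> x; apply/curve_derivP; split=> /=; first exact: fg.
exact: is_derive_cst.
Qed.

End RealSmoothFunctions.

(** * Bump functions *)

Section BumpFunctions.
Variables (R : realType) (n : nat).
Local Notation Rn := 'rV[R]_n.
Local Notation C := (@lcsC R).
Implicit Types (x a : Rn) (r : R).

Definition box_bump a r x : R := \prod_(i < n) flat 0 (r ^+ 2 - (x 0 i - a 0 i) ^+ 2).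

Lemma smoothR_box_bump N a r : smoothR N (box_bump a r).
Proof.
apply: smoothR_prod => i.
have -> : (fun x : Rn => flat 0 (r ^+ 2 - (x 0 i - a 0 i) ^+ 2)) =
    flat 0 \o (fun x : Rn => r ^+ 2 + -1 * ((x 0 i + - a 0 i) * (x 0 i + - a 0 i))).
  by apply/funext => x /=; rewrite mulN1r -expr2.
apply: smoothR_comp; first exact: smooth1_flat.
apply: smoothRD; first exact: smoothR_cst.
apply: smoothRM; first exact: smoothR_cst.
by apply: smoothRM; apply: smoothRD; (exact: smoothR_coord || exact: smoothR_cst).
Qed.

Lemma box_bump_ge0 a r x : 0 <= box_bump a r x.
Proof. by apply: prodr_ge0 => i _; exact: flat_ge0. Qed.

Lemma box_bump_gt0 a r x : `|x - a| < r -> 0 < box_bump a r x.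
Proof.
move=> xr; have r0 : 0 < r by exact: le_lt_trans xr.
apply: prodr_gt0 => i _; apply: flat_gt0; rewrite subr_gt0.
rewrite -real_normK ?num_real// ltr_pXn2r ?nnegrE ?(ltW r0)//.
by apply: le_lt_trans xr; have := normr_coord (x - a) i; rewrite !mxE.
Qed.

Lemma box_bump_neq0 a r x : 0 < r -> box_bump a r x != 0 -> `|x - a| <= r.
Proof.
move=> r0 /prodf_neq0 nz; rewrite [leLHS]/Num.norm /= mx_normrE.
apply: bigmax_le => [|[k i] _ /=]; first exact: ltW.
rewrite leNgt; apply/negP => ri; have /eqP := nz i isT; apply.
apply: flat_le0; rewrite subr_le0 -[leRHS]real_normK ?num_real//.
by rewrite ler_pXn2r ?nnegrE ?(ltW r0)//; move: ri; rewrite !mxE (ord1 k) => /ltW.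
Qed.

Lemma compact_closed_ball a r : compact [set x : Rn | `|x - a| <= r].
Proof.
apply: bounded_closed_compact.
  exists (`|a| + r); split; first exact: num_real.
  move=> M HM x /= xr; rewrite -(subrK a x) (le_trans (ler_normD _ _))// addrC.
  by rewrite ltW// (le_lt_trans _ HM)// lerD2l.
have cn : continuous (fun x : Rn => `|x - a|).
  move=> x; apply: (@continuous_comp _ _ _ (fun x : Rn => x - a) Num.norm x).
    exact: continuous_translate.
  exact: norm_continuous.
apply: (@closed_comp _ _ (fun x => `|x - a|) [set y : R | y <= r]) => [x _|].
  exact: cn.
exact: closed_le.
Qed.

Lemma compact_balls (s : seq Rn) (r : Rn -> R) :
  compact [set x : Rn | exists2 a, a \in s & `|x - a| <= r a].
Proof.
elim: s => [|a s IH].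
  rewrite (_ : [set _ | _] = set0); first exact: compact0.
  by apply/seteqP; split=> x // [].
rewrite (_ : [set _ | _] = [set x | `|x - a| <= r a] `|`
    [set x | exists2 b, b \in s & `|x - b| <= r b]).
  by apply: compactU => //; exact: compact_closed_ball.
apply/seteqP; split=> x /=.
  by move=> [b]; rewrite inE => /predU1P[->|bs] xb; [left|right; exists b].
move=> [xa|[b bs xb]]; first by exists a => //; exact: mem_head.
by exists b => //; rewrite inE bs orbT.
Qed.

(** A finite sum [F] of box bumps is positive on [K], hence at least [2 c] there
    for some [c > 0]; [1 - flat 0 (c - F) / flat 0 c] is then equal to 1 where
    [F > c] and vanishes with [F]. *)
Lemma bump_exists (K V : set Rn) : compact K -> open V -> K `<=` V ->
  exists2 chi, is_test V chi &
    exists N, [/\ open N, K `<=` N & forall x, N x -> chi x = (1 : R[i]) :> C].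
Proof.
move=> cK oV KV.
have [K0|/set0P K0] := eqVneq K set0.
  exists (fun=> 0); last first.
    by exists set0; split; [exact: open0|rewrite K0|move=> x []].
  have e : fsupp (fun _ : Rn => 0 : C) = set0.
    rewrite /fsupp (_ : [set _ | _] = set0) ?closure0//.
    by apply/seteqP; split=> x //=; rewrite eqxx.
  by split; [exact: smoothT0|rewrite e; exact: compact0|rewrite e].
have /choice[r rP] a : exists r : R, 0 < r /\
    (K a -> [set x | `|x - a| <= r] `<=` V).
  have [Ka|nKa] := pselect (K a); last by exists 1.
  have /nbhs_ballP[d /= d0 Hd] : nbhs a V.
    by apply: open_nbhs_nbhs; split=> //; exact: KV.
  exists (d / 2); split=> [|_ x /= xd]; first by rewrite divr_gt0.
  apply: Hd; rewrite -ball_normE /ball_ /= distrC (le_lt_trans xd)//.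
  by rewrite ltr_pdivrMr// ltr_pMr// ltr1n.
have r0 a := (rP a).1.
have [D DK KD] : finite_subset_cover K (fun a => [set x : Rn | `|x - a| < r a]) K.
  have := cK; rewrite compact_cover; apply.
    move=> a _; rewrite (_ : [set _ | _] = ball a (r a)); first exact: ball_open.
    by rewrite -ball_normE; apply/seteqP; split=> x /=; rewrite distrC.
  by move=> a Ka; exists a => //=; rewrite subrr normr0.
pose F x := \sum_(a <- finmap.enum_fset D) box_bump a (r a) x.
pose T := [set x : Rn | exists2 a, a \in finmap.enum_fset D & `|x - a| <= r a].
have sF N : smoothR N F by apply: smoothR_sum => a; exact: smoothR_box_bump.
have cF : continuous F := smoothR_continuous (sF 0%N).
have F0 x : 0 <= F x by apply: sumr_ge0 => a _; exact: box_bump_ge0.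
have FK x : K x -> 0 < F x.
  move=> /KD[a /= aD xa]; rewrite /F (big_rem a)//= ltr_pwDl ?box_bump_gt0//.
  by apply: sumr_ge0 => b _; exact: box_bump_ge0.
have FT x : F x != 0 -> T x.
  move=> Fx; apply: contrapT => nT; move/eqP: Fx; apply.
  rewrite /F big_seq big1// => a aD; apply/eqP; apply: contrapT => /negP nz.
  by apply: nT; exists a => //; exact: box_bump_neq0.
have cT : compact T by exact: compact_balls.
have TV : T `<=` V.
  by move=> x [a aD xa]; apply: (rP a).2 xa; apply/set_mem; exact: DK.
have [x0 Kx0 minF] := EVT_min_rV K0 cK (continuous_subspaceT cF).
pose c := F x0 / 2.
have Fx0 : 0 < F x0 by apply: FK; exact/set_mem.
have c0 : 0 < c by rewrite divr_gt0.
pose chi x := 1 + - (flat 0 c)^-1 * flat 0 (c + -1 * F x).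
have schi N : smoothR N chi.
  apply: smoothRD; first exact: smoothR_cst.
  apply: smoothRM; first exact: smoothR_cst.
  apply: (@smoothR_comp R n N (flat 0) (fun x => c + -1 * F x)).
    exact: smooth1_flat.
  apply: smoothRD; first exact: smoothR_cst.
  by apply: smoothRM; first exact: smoothR_cst.
have fc : flat 0 c != 0 by rewrite gt_eqF// flat_gt0.
have sub : fsupp (fun x => (chi x)%:C%C : C) `<=` T.
  rewrite ((closure_id T).1 (compact_closed_rV cT)); apply: closure_subset.
  move=> x /= nz; apply: FT; apply/eqP => Fx; move/eqP: nz; apply.
  by rewrite /chi Fx mulr0 addr0 mulNr mulVf// subrr.
exists (fun x => (chi x)%:C%C).
  split; [exact: smoothR_smooth_on| |exact: subset_trans TV].
  by apply: subclosed_compact cT sub; exact: closed_closure.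
exists [set x | c < F x]; split.
- apply: (@open_comp _ _ F [set y | c < y]) => [x _|]; first exact: cF.
  exact: open_gt.
- move=> x Kx /=; apply: lt_le_trans (minF x (mem_set Kx)).
  by rewrite /c ltr_pdivrMr// ltr_pMr// ltr1n.
- move=> x /= cx; rewrite /chi (@flat_le0 _ 0 (c + -1 * F x)); first by rewrite mulr0 addr0 rmorph1.
  by rewrite mulN1r subr_le0 ltW.
Qed.

End BumpFunctions.

(** * The integral of a bounded function with bounded support *)

Section BoundedIntegral.
Variable R : realType.
Local Open Scope ereal_scope.

(** The integral of a nonnegative function, measurable or not, is a supremum over
    the simple functions below it. *)
Lemma ge0_le_integralT d (T : measurableType d)
    (mu : {measure set T -> \bar R}) (f g : T -> \bar R) :
  (forall t, 0 <= f t) -> (forall t, f t <= g t) ->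
  \int[mu]_t f t <= \int[mu]_t g t.
Proof.
move=> f0 fg; have g0 t : 0 <= g t by exact: le_trans (fg t).
rewrite !ge0_integralTE//; apply: ereal_sup_le => x [h /= hf <-].
by exists h => //= t; exact: le_trans (fg t).
Qed.

Lemma normr_Rintegral_le d (T : measurableType d)
    (mu : {measure set T -> \bar R}) (B : set T) (h : T -> R) (A : R) :
  measurable B -> mu B < +oo -> (0 <= A)%R ->
  (forall t, (`|h t| <= A)%R) -> (forall t, ~ B t -> h t = 0%R) ->
  (`|Rintegral mu setT h| <= A * fine (mu B))%R.
Proof.
move=> mB fB A0 hA hB.
have fin : mu B \is a fin_num by rewrite ge0_fin_numE.
pose AB := A%:E * mu B.
have bnd (f : T -> \bar R) : (forall t, 0 <= f t) ->
    (forall t, f t <= `|(h t)%:E|) -> 0 <= \int[mu]_t f t <= AB.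
  move=> f0 fh; rewrite integral_ge0//=.
  rewrite /AB -integral_cst// [leRHS]integral_mkcond; apply: ge0_le_integralT => // t.
  rewrite (le_trans (fh t))// /patch; case: ifPn => [_|/negP nB].
    by rewrite lee_fin.
  by rewrite hB ?abse0// => Bt; apply: nB; exact: mem_set.
have maxle (x : \bar R) : maxe x 0 <= `|x| by rewrite ge_max abse_ge0 lee_abs.
have /andP[p0 pA] : 0 <= \int[mu]_t (EFin \o h)^\+ t <= AB.
  apply: bnd => t; first exact: funepos_ge0.
  by rewrite funeposE.
have /andP[n0 nA] : 0 <= \int[mu]_t (EFin \o h)^\- t <= AB.
  apply: bnd => t; first exact: funeneg_ge0.
  by rewrite funenegE (le_trans (maxle _))// abseN.
have fAB : AB \is a fin_num by rewrite /AB fin_numM.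
have fp : \int[mu]_t (EFin \o h)^\+ t \is a fin_num.
  by rewrite ge0_fin_numE// (le_lt_trans pA)// ltey_eq fAB.
have fn : \int[mu]_t (EFin \o h)^\- t \is a fin_num.
  by rewrite ge0_fin_numE// (le_lt_trans nA)// ltey_eq fAB.
rewrite /Rintegral (_ : (A * fine (mu B))%R = fine AB); last by rewrite /AB fineM.
rewrite integralE fineB// ler_norml.
move: p0 pA n0 nA; rewrite -(fineK fp) -(fineK fn) -(fineK fAB) !lee_fin => p0 pA n0 nA.
by apply/andP; split; lra.
Qed.

Local Notation RB := (measurableTypeR R).

Definition cube n (M : R) : set (n.-tuple RB) :=
  [set t | forall i, (`|(tnth t i : R)| <= M)%R].

Lemma measurable_cube n M : measurable (@cube n M).
Proof.
rewrite (_ : cube M = \bigcap_(i in [set: 'I_n])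
    ((fun t => tnth t i) @^-1` `[(- M)%R, M])).
  apply: fin_bigcap_measurable => [|i _]; first exact: finite_finset.
  by rewrite -[X in measurable X]setTI; apply: measurable_tnth.
apply/seteqP; split=> t /=.
  by move=> tM i _ /=; rewrite in_itv /= -ler_norml.
by move=> tM i; have := tM i I; rewrite /= in_itv /= -ler_norml.
Qed.

Lemma cube_lty n M : lebesgue_tuple R n (@cube n M) < +oo.
Proof.
elim: n => [|n IH].
  by rewrite /= diracE; case: (_ \in _); rewrite ltry.
rewrite [lebesgue_tuple _ _]/= measure_consE /pushforward.
rewrite (_ : _ @^-1` _ = `[(- M)%R, M]%classic `*` cube M); last first.
  apply/seteqP; split=> -[x t] /=.
    move=> H; split; first by have := H ord0; rewrite in_itv/= -ler_norml.
    by move=> i; have := H (lift ord0 i); rewrite tnthS.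
  move=> [xM tM] i; case: (unliftP ord0 i) => [j ->|->]; first by rewrite tnthS.
  by move: xM; rewrite in_itv/= -ler_norml.
rewrite product_measure2E//; last exact: measurable_cube.
apply: lte_mul_pinfty => //.
have E := @lebesgue_measure_itv R `[(- M)%R, M].
rewrite -[X in X \is a _]/(lebesgue_measure [set` `[(- M)%R, M]]) E.
by case: ifP.
Qed.

Lemma integralC_bound n (f : 'rV[R]_n -> R[i]) (A M : R) : (0 <= A)%R ->
  (forall y, (normc (f y) <= A)%R) ->
  (forall y, f y != 0%R -> forall i, (`|y ord0 i| <= M)%R) ->
  (normc (integralC f) <= 2 * (A * fine (lebesgue_tuple R n (@cube n M))))%R.
Proof.
move=> A0 fA fM; apply: (le_trans (normc_le _)) => /=.
have supp (t : n.-tuple RB) : ~ cube M t -> f (\row_i (tnth t i : R)) = 0%R.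
  move=> ct; apply/eqP; apply: contrapT => /negP nz; apply: ct => i.
  by have := fM _ nz i; rewrite mxE.
rewrite mulr2n mulrDl !mul1r lerD//; apply: normr_Rintegral_le => //;
  try exact: measurable_cube; try exact: cube_lty.
- by move=> t; exact: (le_trans (normr_Re_le _) (fA _)).
- by move=> t /supp ->.
- by move=> t; exact: (le_trans (normr_Im_le _) (fA _)).
- by move=> t /supp ->.
Qed.

End BoundedIntegral.

(** * Kernels that agree with the translates near a compact set *)

Section LocalKernels.
Variables (R : realType) (n : nat).
Local Notation Rn := 'rV[R]_n.
Local Notation C := (@lcsC R).
Implicit Types (K L U W Omega : set Rn) (phi : Rn -> C) (x y : Rn).

Lemma well_insideP K U : open U -> well_inside K U <-> compact K /\ K `<=` U.
Proof.
move=> oU; split=> -[cK KU]; split=> //.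
  by move=> x /KU; exact: interior_subset.
by move=> x Kx; apply: open_nbhs_nbhs; split=> //; exact: KU.
Qed.

(** The tube lemma for addition. *)
Lemma open_translates K W : compact K -> open W ->
  open [set x | forall y, K y -> W (x + y)].
Proof.
move=> cK oW; rewrite openE => x /= xKW.
apply: ((compact_near_coveringP K).1 cK _ (nbhs x) (fun x y => W (x + y))).
move=> y Ky; have nW : nbhs (x + y) W.
  by apply: open_nbhs_nbhs; split=> //; exact: xKW.
have [[A B] [nA nB] AB] := @add_continuous _ (x, y) _ nW.
exists (B, A); first by split.
by move=> [y' x'] [/= By' Ax']; exact: (AB (x', y')).
Qed.

(** The support of a bump around [K] is a compact neighbourhood of [K]. *)
Lemma compact_neighborhood K U : compact K -> open U -> K `<=` U ->
  exists L Q, [/\ compact L, L `<=` U, open Q, K `<=` Q & Q `<=` L].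
Proof.
move=> cK oU KU.
have [chi [_ cchi chiU] [Q [oQ KQ Q1]]] := bump_exists cK oU KU.
exists (fsupp chi), Q; split=> // x Ox; apply: subset_closure => /=.
by rewrite Q1// oner_neq0.
Qed.

(** Multiplying the translates of [phi] by a bump around [K] gives an admissible
    kernel that agrees with them near [K]. *)
Lemma local_kernel K U Q L phi : compact K -> open U -> K `<=` U -> open Q ->
  Q `<=` L -> is_test setT phi -> supp_sub K Q phi ->
  exists chi N, [/\ fsupp chi `<=` U, kernel_span L (cutoff_kernel chi phi),
    open N, K `<=` N & forall x, N x -> cutoff_kernel chi phi x = shift_kernel phi x].
Proof.
move=> cK oU KU oQ QL tphi KQ; have [_ cphi _] := tphi.
pose V := U `&` [set x | forall y, fsupp phi y -> Q (x + y)].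
have oV : open V by apply: openI => //; exact: open_translates.
have KV : K `<=` V by move=> x Kx; split; [exact: KU|move=> y; exact: KQ].
have [chi [schi cchi chiV] [N [oN KN N1]]] := bump_exists cK oV KV.
exists chi, N; split=> //.
- by move=> x /chiV[].
- apply: kernel_cutoff => // x y /chiV[_ xO] py; exact/QL/xO.
- by move=> x Nx; apply/funext => y; rewrite /cutoff_kernel N1// mul1r.
Qed.

Lemma cutoff_kernel_out chi phi x : ~ fsupp chi x ->
  cutoff_kernel chi phi x = 0.
Proof.
by move=> cx; apply/funext => y; rewrite /cutoff_kernel (notin_fsupp cx) mul0r.
Qed.

Lemma smooth_on_local U (f : Rn -> C) :
  (forall x, U x -> exists2 N, N x & smooth_on N f) -> smooth_on U f.
Proof.
move=> H; split=> // s g x Ux; have [N Nx [_ sf]] := H x Ux; exact: sf.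
Qed.

Lemma eq_on_fnorm K N m (f g : Rn -> C) : open N -> K `<=` N ->
  (forall x, N x -> f x = g x) -> fnorm K m f = fnorm K m g.
Proof.
move=> oN KN fg; rewrite /fnorm /sup_seminorm; congr sup; apply/seteqP.
by split=> _ [x [a [Kx am ->]]]; exists x, a; split=> //;
  rewrite (eq_on_mderiv a oN fg (KN _ Kx)).
Qed.

End LocalKernels.

(** * From the basic space to its elementary version *)

Section Transfer.
Variables (R : realType) (n : nat) (Omega : set 'rV[R]_n).
Local Notation Rn := 'rV[R]_n.
Local Notation C := (@lcsC R).
Implicit Types (K L U : set Rn) (phi : Rn -> C) (x y : Rn) (T : hom_family R n).
Hypothesis oOmega : open Omega.

(** The case of a single point [x], with [L] a compact neighbourhood of
    [x + supp phi]. *)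
Lemma local_kernel_at phi x : Uset Omega phi x -> exists G N,
  [/\ lcs_carrier (Cinfty Omega (testfun Omega)) G, open N, N x &
    forall x', N x' -> G x' = shift_kernel phi x'].
Proof.
move=> [tphi Ox xO]; have [_ cphi _] := tphi.
have cS : compact [set x + y | y in fsupp phi].
  have -> : [set x + y | y in fsupp phi] = [set y - (- x) | y in fsupp phi].
    by apply/seteqP; split=> _ [y py <-]; exists y => //; rewrite opprK addrC.
  apply: continuous_compact => //; apply: continuous_subspaceT.
  exact: continuous_translate.
have SO : [set x + y | y in fsupp phi] `<=` Omega by move=> _ [y py <-]; exact: xO.
have [L [Q [cL LQ oQ SOO QL]]] := compact_neighborhood cS oOmega SO.
have [] := @local_kernel R n [set x] Omega Q L phi _ oOmega _ oQ QL tphi.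
- exact: compact_set1.
- by move=> _ ->.
- by move=> _ y -> py; apply: SOO; exists y.
move=> chi [N [chiO kG oN Nx NG]]; exists (cutoff_kernel chi phi), N; split=> //.
  split; first exact: (kernel_smooth_testfun oOmega cL LQ).
  by move=> z Oz; apply: cutoff_kernel_out => /chiO.
exact: Nx.
Qed.

Lemma near_of_open N x (G : Rn -> Rn -> C) phi : open N -> N x ->
  (forall x', N x' -> G x' = shift_kernel phi x') ->
  \forall x' \near x, G x' = shift_kernel phi x'.
Proof. by move=> oN Nx H; have := open_nbhs_nbhs (conj oN Nx); exact: filterS. Qed.

Lemma tildeB_basic T : basicB Omega T -> basicBc Omega (tildeB Omega T).
Proof.
move=> bT phi tphi; apply: smooth_on_local => x Ux.
have [G [N [cG oN Nx NG]]] := local_kernel_at Ux; have [_ Ox _] := Ux.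
exists (N `&` Omega) => //.
have [[mapT _] _] := bT _ oOmega (@subset_refl _ _).
have [sTG _] := mapT _ cG.
have oNO : open (N `&` Omega) by exact: openI.
apply: (eq_on_smooth oNO _ (smooth_sub (@subIsetr _ _ _) sTG)) => z [Nz Oz].
by rewrite (tildeBE oOmega bT Oz cG)//; exact: near_of_open NG.
Qed.

Lemma tildeB_iota (u : (Rn -> C) -> C) phi x : Uset Omega phi x ->
  tildeB Omega (iotaB u) phi x = iotaBc u phi x.
Proof.
move=> Ux; have [G [N [cG oN Nx NG]]] := local_kernel_at Ux; have [_ Ox _] := Ux.
rewrite /tildeB; set P := [set _ | _]; have [_ nw] : P (xget 0 P).
  by apply: xgetPex; exists G; split=> //; exact: near_of_open NG.
by rewrite /iotaB /zero_restr /patch mem_set// (nbhs_singleton nw).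
Qed.

Lemma tildeB_sigma (f : Rn -> C) phi x : Uset Omega phi x ->
  tildeB Omega (sigmaB f) phi x = sigmaBc f phi x.
Proof.
by move=> [_ Ox _]; rewrite /tildeB /sigmaB /zero_restr /patch mem_set.
Qed.

Lemma dk0 T U (vphi : 'I_1 -> Rn -> Rn -> C) : dk T U vphi = T U (vphi ord0).
Proof. by rewrite /dk (size0nil (s := enum 'I_0)) ?size_enum_ord. Qed.

(** The hypothesis [K + supp phi <= L] leaves no room to move [x] off [K] within
    [L]; hence the kernel takes its values in the test functions supported in a
    compact neighbourhood [L'] of [L]. The kernel vanishes outside [U], so that
    the compatibility of [T] with restriction exchanges [Omega] for [U]. *)
Lemma tilde_local_kernel T U K L L' Q phi : basicB Omega T -> open U ->
  U `<=` Omega -> compact K -> K `<=` U -> compact L' -> L' `<=` U ->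
  L `<=` Q -> open Q -> Q `<=` L' -> is_test setT phi -> supp_sub K L phi ->
  exists G N, [/\ lcs_carrier (Cinfty U (testfun_supp L' U)) G, open N,
    K `<=` N, forall x, N x -> G x = shift_kernel phi x &
    forall m, fnorm K m (tildeB Omega T phi) = fnorm K m (T U G)].
Proof.
move=> bT oU UO cK KU cL' LU LQ oQ QL tphi KL.
have KQ : supp_sub K Q phi by move=> x y Kx py; exact/LQ/KL.
have [chi [N [chiU kG oN KN NG]]] := local_kernel cK oU KU oQ QL tphi KQ.
set G := cutoff_kernel chi phi in kG NG *; exists G, N; split=> //.
  split; first exact: (kernel_smooth_testfun_supp cL' LU).
  by move=> z Uz; apply: cutoff_kernel_out => /chiU.
have cG : lcs_carrier (Cinfty Omega (testfun Omega)) G.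
  split; first exact: (kernel_smooth_testfun oOmega cL' (subset_trans LU UO)).
  by move=> z Oz; apply: cutoff_kernel_out => /chiU/UO.
have GU : zero_restr (testfun Omega) U G = G.
  apply/funext => z; rewrite /zero_restr /patch; case: ifPn => // /negP nU.
  by apply/esym/cutoff_kernel_out => /chiU Uz; apply: nU; exact: mem_set.
have [_ /(_ U oU UO G cG)] := bT Omega oOmega (@subset_refl _ _); rewrite GU => TU.
move=> m; apply: (@eq_on_fnorm _ _ _ (N `&` U)) => [| |z [Nz Uz]].
- exact: openI.
- by move=> z Kz; split; [exact: KN|exact: KU].
rewrite (tildeBE oOmega bT (UO _ Uz) cG); last exact: near_of_open NG.
by rewrite -TU /zero_restr /patch mem_set.
Qed.

Lemma pderivs_shift_kernel phi s x y : smooth_on setT phi ->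
  pderivs s (fun x' => shift_kernel phi x' y) x =
  ((-1) ^+ size s * pderivs s phi (y - x) : R[i]).
Proof. by move=> sphi; rewrite /shift_kernel pderivs_reflect. Qed.

Lemma normc_sign k (z : R[i]) : normc ((-1) ^+ k * z) = normc z.
Proof.
by elim: k => [|k IH]; rewrite ?expr0 ?mul1r// exprS -mulrA mulN1r normcN.
Qed.

(** Over [K] the derivatives of the kernel are, up to sign, derivatives of [phi]
    of order at most [c + l], taken at [y - x]. *)
Lemma vnorm_le_fnorm K N c L l G phi : is_test setT phi -> open N -> K `<=` N ->
  (forall x, N x -> G x = shift_kernel phi x) ->
  vnorm K c L l G <= fnorm setT (c + l) phi.
Proof.
move=> tphi oN KN NG; have [sphi _ _] := tphi.
apply: le_sup_bound => [|_ [x [a [y [b [Kx ac Ly bl ->]]]]]]; first exact: fnorm_ge0.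
have E z : N z -> mderiv b (G z) y = pderivs (index_seq b) phi (y - z).
  by move=> Nz; rewrite NG// mderivE /shift_kernel pderivs_shift.
rewrite (eq_on_mderiv a oN E (KN _ Kx)) mderivE.
rewrite pderivs_reflect; last exact: smooth_pderivs.
rewrite normc_sign -pderivs_cat; apply: pderivs_le_fnorm tphi _.
by rewrite size_cat !size_index_seq leq_add.
Qed.

Lemma meval_le k (lam : mpoly.mpoly k R) (v w : 'I_k -> R) : nonneg_coeffs lam ->
  (forall i, 0 <= v i) -> (forall i, v i <= w i) ->
  mpoly.meval v lam <= mpoly.meval w lam.
Proof.
move=> lam0 v0 vw; rewrite !mpoly.mevalE; apply: ler_sum => m _.
apply: ler_wpM2l; first exact: lam0.
apply: ler_prod => i _; rewrite exprn_ge0//=.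
by apply: lerXn2r; rewrite ?nnegrE// (le_trans (v0 i)).
Qed.

Lemma vnorm_ge0 K c L l G : 0 <= @vnorm R n K c L l G.
Proof. by apply: ge0_sup => _ [x [a [y [b [_ _ _ _ ->]]]]]; exact: normc_ge0. Qed.

Lemma dnorm_ge0 K c B G : 0 <= @dnorm R n K c B G.
Proof. by apply: ge0_sup => _ [x [a [f [_ _ _ ->]]]]; exact: normc_ge0. Qed.

Lemma tildeB_moderate T : moderateB Omega T -> moderateBc Omega (tildeB Omega T).
Proof.
move=> [bT mT]; split; first exact: tildeB_basic.
move=> x Ox; have [U [oU Ux UO HU]] := mT x Ox; exists U; split=> //.
move=> K L wK wL _ m; have [cK KU] := (well_insideP K oU).1 wK.
have [cL LU] := (well_insideP L oU).1 wL.
have [L' [Q [cL' LU' oQ LQ QL]]] := compact_neighborhood cL oU LU.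
have wL' : well_inside L' U by exact/well_insideP.
have [c [l [lam [lamP Hlam]]]] := HU K L' wK wL' m 0%N.
exists (c + l)%N, lam; split=> // phi tphi KL.
have [G [N [cG oN KN NG ->]]] :=
  tilde_local_kernel bT oU UO cK KU cL' LU' LQ oQ QL tphi KL.
have := Hlam (fun=> G) (fun=> cG); rewrite dk0 => /le_trans; apply.
apply: meval_le => // i; first exact: vnorm_ge0.
exact: (vnorm_le_fnorm _ _ _ tphi oN KN NG).
Qed.

Definition restrict_all U (B : set (Rn -> C)) : set (Rn -> C) :=
  [set zero_restr lcsC U f | f in B].

Lemma zero_restrE U (f : Rn -> C) x : U x -> zero_restr lcsC U f x = f x.
Proof. by move=> Ux; rewrite /zero_restr /patch mem_set. Qed.

Lemma bounded_restrict_all U B : open U -> U `<=` Omega ->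
  lcs_bounded (Cinfty Omega lcsC) B -> lcs_bounded (Cinfty U lcsC) (restrict_all U B).
Proof.
move=> oU UO [BC Bb]; split=> [_ [f Bf <-]|q [K [m [p [wK hp ->]]]]].
  have [sf _] := BC _ Bf; split.
    apply: (eq_on_smooth oU _ (smooth_sub UO sf)) => x Ux.
    by rewrite zero_restrE.
  by move=> x nUx; rewrite /zero_restr /patch; case: ifPn => // /set_mem.
have [cK KU] := (well_insideP K oU).1 wK.
have wKO : well_inside K Omega.
  by apply/(well_insideP _ oOmega); split=> //; exact: subset_trans UO.
have [M HM] : exists M : R, forall f, B f -> sup_seminorm p K m f <= M.
  by apply: Bb; exists K, m, p.
exists M => _ [f Bf <-]; apply: le_trans (HM _ Bf).
rewrite hp -!/(fnorm K m _) (eq_on_fnorm m oU KU (g := f))// => x.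
exact: zero_restrE.
Qed.

(** A supremum over an unbounded set is 0, so monotonicity of [dnorm] in the order
    of differentiation needs this bound: the integrand vanishes off [L] and is
    bounded there, uniformly for [f] in [B]. *)
Lemma dnorm_bounded U K L c B phi : open U -> compact K -> K `<=` U ->
  compact L -> L `<=` U -> lcs_bounded (Cinfty U lcsC) B -> is_test setT phi ->
  supp_sub K L phi -> exists M, forall x a f, K x -> (mlength a <= c)%N -> B f ->
    normc (pairing f a (shift_kernel phi) x - mderiv a f x) <= M.
Proof.
move=> oU cK KU cL LU [BC Bb] tphi KL; have [sphi _ _] := tphi.
have bd K' m : compact K' -> K' `<=` U ->
    exists2 M, 0 <= M & forall f, B f -> fnorm K' m f <= M.
  move=> cK' KU'; have [M HM] : exists M : R, forall f, B f -> fnorm K' m f <= M.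
    apply: Bb; exists K', m, (fun z : C => normc z); split=> //.
    exact/well_insideP.
  by exists `|M| => // f /HM/le_trans; apply; exact: ler_norm.
have [M1 _ HM1] := bd K c cK KU; have [M0 M00 HM0] := bd L 0%N cL LU.
have [D [_ HD]] := compact_bounded cL.
set P := fnorm setT c phi; have P0 : 0 <= P := fnorm_ge0 _ _ _.
exists (2 * (M0 * P * fine (lebesgue_tuple R n (cube (D + 1)))) + M1).
move=> x a f Kx ac Bf; have [sf _] := BC _ Bf.
rewrite (le_trans (normcB _ _))// lerD//; last first.
  exact: le_trans (mderiv_le_fnorm sf cK KU ac Kx) (HM1 _ Bf).
have vanish y : ~ L y -> mderiv a (fun x' => shift_kernel phi x' y) x = 0.
  move=> nLy; rewrite mderivE pderivs_shift_kernel// notin_fsupp ?mulr0//.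
  move=> /fsupp_pderivs py; apply: nLy.
  by have := KL _ _ Kx py; rewrite addrC subrK.
apply: integralC_bound; first exact: mulr_ge0.
  move=> y; have [Ly|nLy] := pselect (L y); last first.
    by rewrite vanish// mulr0 normc0 mulr_ge0.
  rewrite normcM ler_pM ?normc_ge0//.
    have [b sb E] := perm_index_seq ([::] : seq 'I_n).
    have -> : f y = mderiv b f y.
      by rewrite mderivE; move: E; rewrite perm_sym => /perm_nilP ->.
    apply: le_trans (HM0 _ Bf); apply: (mderiv_le_fnorm sf) => //.
    by rewrite sb.
  rewrite mderivE pderivs_shift_kernel// normc_sign.
  by apply: pderivs_le_fnorm tphi _; rewrite size_index_seq.
move=> y nz i; have Ly : L y.
  by apply: contrapT => /vanish z; move/eqP: nz; apply; rewrite z mulr0.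
apply: le_trans (normr_coord y i) _; apply: HD Ly.
by rewrite ltrDl.
Qed.

(** For [x] in [K] the pairing only sees [f] on [x + supp phi], which lies in [L],
    and the derivative of [f] at [x] only sees it near [x]; hence restricting the
    bounded set to [U] changes nothing. *)
Lemma dnorm_le U K N L c c' B G phi : open U -> U `<=` Omega -> compact K ->
  K `<=` U -> compact L -> L `<=` U -> lcs_bounded (Cinfty Omega lcsC) B ->
  is_test setT phi -> supp_sub K L phi -> open N -> K `<=` N ->
  (forall x, N x -> G x = shift_kernel phi x) -> (c <= c')%N ->
  dnorm K c B G <= dnorm K c' (restrict_all U B) (shift_kernel phi).
Proof.
move=> oU UO cK KU cL LU bB tphi KL oN KN NG cc'; have [sphi _ _] := tphi.
have [M HM] := dnorm_bounded c' oU cK KU cL LU (bounded_restrict_all oU UO bB)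
  tphi KL.
apply: le_sup_bound => [|_ [x [a [f [Kx ac Bf ->]]]]]; first exact: dnorm_ge0.
apply: (@ub_le_sup_of _ _ M).
  by move=> _ [z [b [g [Kz bc Bg ->]]]]; exact: HM.
exists x, a, (zero_restr lcsC U f); split=> //; first exact: leq_trans cc'.
  by exists f.
congr normc; congr (_ - _); last first.
  by apply: (eq_on_mderiv a oU _ (KU _ Kx)) => z Uz; rewrite zero_restrE.
rewrite /pairing; congr integralC; apply/funext => y.
have -> : mderiv a (fun x' => G x' y) x =
    mderiv a (fun x' => shift_kernel phi x' y) x.
  by apply: (eq_on_mderiv a oN _ (KN _ Kx)) => z Nz; rewrite NG.
have [Uy|nUy] := pselect (U y); first by rewrite zero_restrE.
rewrite mderivE pderivs_shift_kernel// (notin_fsupp (f := pderivs _ phi)).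
  by rewrite !mulr0.
move=> /fsupp_pderivs py; apply: nUy; apply: LU.
by have := KL _ _ Kx py; rewrite addrC subrK.
Qed.

Lemma tildeB_negligible T :
  negligibleB Omega T -> negligibleBc Omega (tildeB Omega T).
Proof.
move=> [bT nT]; split; first exact: tildeB_basic.
move=> x Ox; have [U [oU Ux UO HU]] := nT x Ox; exists U; split=> //.
move=> K L wK wL _ m; have [cK KU] := (well_insideP K oU).1 wK.
have [cL LU] := (well_insideP L oU).1 wL.
have [L' [Q [cL' LU' oQ LQ QL]]] := compact_neighborhood cL oU LU.
have wL' : well_inside L' U by exact/well_insideP.
have [c [l [lam [B [lamI bB Hlam]]]]] := HU K L' wK wL' m 0%N.
exists (c + l)%N, lam, (restrict_all U B); split=> //.
  exact: bounded_restrict_all.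
move=> phi tphi KL; have [G [N [cG oN KN NG ->]]] :=
  tilde_local_kernel bT oU UO cK KU cL' LU' LQ oQ QL tphi KL.
have := Hlam (fun=> G) (fun=> cG); rewrite dk0 => /le_trans; apply.
have [lam0 _] := lamI; apply: meval_le => // i; rewrite /yz_args; case: (fintype.split i) => j.
- exact: vnorm_ge0.
- by rewrite (ord1 j) eqxx; exact: dnorm_ge0.
- exact: (vnorm_le_fnorm _ _ _ tphi oN KN NG).
- rewrite (ord1 j) eqxx.
  by apply: (dnorm_le oU UO cK KU cL LU bB tphi KL oN KN NG); exact: leq_addr.
Qed.

End Transfer.

Theorem proposition30 (R : realType) (n : nat) (Omega : set 'rV[R]_n)
    (openOmega : open Omega) :
  [/\ forall T : hom_family R n, basicB Omega T ->
        basicBc Omega (tildeB Omega T),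
      forall u : ('rV[R]_n -> @lcsC R) -> lcsC,
        is_distribution Omega u ->
        forall phi x, Uset Omega phi x ->
          tildeB Omega (iotaB u) phi x = iotaBc u phi x,
      forall f : 'rV[R]_n -> @lcsC R,
        lcs_carrier (Cinfty Omega lcsC) f ->
        forall phi x, Uset Omega phi x ->
          tildeB Omega (sigmaB f) phi x = sigmaBc f phi x,
      forall T : hom_family R n, moderateB Omega T ->
        moderateBc Omega (tildeB Omega T) &
      forall T : hom_family R n, negligibleB Omega T ->
        negligibleBc Omega (tildeB Omega T)].
Proof.
split.
- exact: tildeB_basic.
- by move=> u _ phi x; exact: tildeB_iota.
- by move=> f _ phi x; exact: tildeB_sigma.
- exact: tildeB_moderate.
- exact: tildeB_negligible.
Qed.
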